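(* Let $R$ be a universally catenary integral domain with fraction field $K$. The following are equivalent: (a) $R$ is perinormal. (b) For each prime ideal $\mathfrak{p}$ of $R$, $R_{\mathfrak{p}}$ is the only ring $S$ with $R_{\mathfrak{p}} \subseteq S \subseteq K$ such that the induced map $\operatorname{Spec} S \to \operatorname{Spec} R_{\mathfrak{p}}$ is an order-reflecting bijection. (c) $R$ satisfies (R$_1$), and for each prime ideal $\mathfrak{p}$ of $R$, $R_{\mathfrak{p}}$ is the only ring $S$ lying between $R_{\mathfrak{p}}$ and its integral closure such that the induced map $\operatorname{Spec} S \to \operatorname{Spec} R_{\mathfrak{p}}$ is an order-reflecting bijection.
   Context: All rings are commutative with identity. ''Local'' means having a unique maximal ideal. An overring of a domain $R$ is a ring between $R$ and its fraction field. A ring extension $A \subseteq B$ satisfies going-down if whenever $\mathfrak{p} \subset \mathfrak{q}$ are primes of $A$ and $Q$ is a prime of $B$ with $Q \cap A = \mathfrak{q}$, there is a prime $P \subseteq Q$ of $B$ with $P \cap A = \mathfrak{p}$. A domain $R$ is perinormal if every local overring $S$ of $R$ such that $R \subseteq S$ satisfies going-down is a localization of $R$ (necessarily at a prime ideal). A ring $R$ satisfies (R$_1$) if $R_P$ is a valuation domain for every height one prime $P$ of $R$. A ring is catenary if for any primes $\mathfrak{p}_1 \subset \mathfrak{p}_2$ between which a saturated chain of primes exists, all saturated chains between them have the same length; a ring is universally catenary if it is Noetherian and every finitely generated algebra over it is catenary. A bijection $\operatorname{Spec} S \to \operatorname{Spec} A$ given by contraction is order-reflecting if whenever $\mathfrak{q}_1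 \subseteq \mathfrak{q}_2$ in $\operatorname{Spec} A$, the primes of $S$ corresponding to them satisfy $Q_1 \subseteq Q_2$. *)

(* Defs.v *)
From HB Require Import structures.
From mathcomp Require Import all_boot all_order all_algebra.
From mathcomp Require Import fraction.
Set Implicit Arguments. Unset Strict Implicit. Unset Printing Implicit Defensive.
Import GRing.Theory.
Local Open Scope ring_scope.

Definition subs {T : Type} (A B : T -> Prop) := forall x, A x -> B x.
Definition seteq {T : Type} (A B : T -> Prop) := forall x, A x <-> B x.
Definition fullset {T : Type} : T -> Prop := fun _ => True.

Section Ideals.
Variable T : comPzRingType.

Definition is_subring (S : T -> Prop) :=
  [/\ S 1, (forall x y, S x -> S y -> S (x - y)) & (forall x y, S x -> S y -> S (x * y))].

Definition ideal_in (S I : T -> Prop) :=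
  [/\ subs I S, I 0, (forall x y, I x -> I y -> I (x + y))
    & (forall a x, S a -> I x -> I (a * x))].

Definition prime_in (S P : T -> Prop) :=
  [/\ ideal_in S P, ~ P 1 & (forall x y, S x -> S y -> P (x * y) -> P x \/ P y)].

Definition maximal_in (S M : T -> Prop) :=
  [/\ ideal_in S M, ~ M 1 &
      (forall J, ideal_in S J -> ~ J 1 -> subs M J -> seteq J M)].

Definition local_in (S : T -> Prop) :=
  exists M, maximal_in S M /\ (forall M', maximal_in S M' -> seteq M' M).

Definition noetherian_ring :=
  forall I : nat -> T -> Prop, (forall n, ideal_in fullset (I n)) ->
    (forall n, subs (I n) (I n.+1)) ->
    exists N, forall m, (N <= m)%N -> subs (I m) (I N).

Definition saturated_chain (p1 p2 : T -> Prop) (n : nat) (c : nat -> T -> Prop) :=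
  [/\ seteq (c 0%N) p1, seteq (c n) p2,
      (forall i, (i <= n)%N -> prime_in fullset (c i)),
      (forall i, (i < n)%N -> subs (c i) (c i.+1) /\ ~ subs (c i.+1) (c i)) &
      (forall i, (i < n)%N -> forall Q, prime_in fullset Q ->
          subs (c i) Q -> subs Q (c i.+1) -> seteq Q (c i) \/ seteq Q (c i.+1))].

Definition catenary_ring :=
  forall p1 p2 n m c d, prime_in fullset p1 -> prime_in fullset p2 -> subs p1 p2 ->
    saturated_chain p1 p2 n c -> saturated_chain p1 p2 m d -> n = m.

End Ideals.

Definition fin_gen_alg (R A : comPzRingType) (f : {rmorphism R -> A}) :=
  exists n (v : 'I_n -> A), forall S : A -> Prop, is_subring S ->
    (forall r, S (f r)) -> (forall i, S (v i)) -> forall a, S a.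

Definition universally_catenary (R : comPzRingType) :=
  noetherian_ring R /\
  forall (A : comPzRingType) (f : {rmorphism R -> A}),
    fin_gen_alg f -> catenary_ring A.

Section Domain.
Variable R : idomainType.
Local Notation K := {fraction R}.
Local Notation "x %:F" := (@FracField.tofrac R x).

Definition primeR (p : R -> Prop) := prime_in fullset p.

Definition loc (p : R -> Prop) : K -> Prop :=
  fun x => exists a b, ~ p b /\ x = a%:F / b%:F.

Definition overring (S : K -> Prop) := is_subring S /\ forall a, S a%:F.

Definition contrR (Q : K -> Prop) : R -> Prop := fun a => Q a%:F.

Definition going_down (S : K -> Prop) :=
  forall p q : R -> Prop, primeR p -> primeR q -> subs p q ->
    forall Q, prime_in S Q -> seteq (contrR Q) q ->
      exists P, [/\ prime_in S P, subs P Q & seteq (contrR P) p].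

Definition perinormal :=
  forall S, overring S -> local_in S -> going_down S ->
    exists p, primeR p /\ seteq S (loc p).

Definition height_one (P : R -> Prop) :=
  [/\ primeR P, (exists x, P x /\ x <> 0) &
      forall Q, primeR Q -> subs Q P -> (forall x, Q x -> x = 0) \/ seteq Q P].

Definition valuation_in (V : K -> Prop) :=
  forall x : K, x <> 0 -> V x \/ V x^-1.

Definition R1 := forall P, height_one P -> valuation_in (loc P).

Definition order_refl_bij (T S : K -> Prop) :=
  let contr (Q : K -> Prop) : K -> Prop := fun x => T x /\ Q x in
  [/\ (forall q, prime_in T q -> exists Q, prime_in S Q /\ seteq (contr Q) q),
      (forall Q1 Q2, prime_in S Q1 -> prime_in S Q2 ->
          seteq (contr Q1) (contr Q2) -> seteq Q1 Q2) &
      (forall Q1 Q2, prime_in S Q1 -> prime_in S Q2 ->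
          subs (contr Q1) (contr Q2) -> subs Q1 Q2)].

Definition int_closure (T : K -> Prop) : K -> Prop :=
  fun x => exists q : {poly K}, [/\ q \is monic, (forall i, T q`_i) & root q x].

End Domain.

(* Main.v *)
Require Import Defs.
From HB Require Import structures.
From mathcomp Require Import all_boot all_order all_algebra.
From mathcomp Require Import fraction generic_quotient.
From mathcomp Require Import boolp classical_sets.
From mathcomp Require Import ring.
Set Implicit Arguments. Unset Strict Implicit. Unset Printing Implicit Defensive.
Import GRing.Theory.
Local Open Scope ring_scope.

(** (a) => (b): a ring with an order-reflecting bijection of spectra is local and
    satisfies going-down, hence is a localization of [R], necessarily at [p].
    (b) => (c): for a height one prime [p], a subring of [K] maximal among those
    containing [R_p] but not [1/x] ([0 <> x \in p]) has the same spectrum as [R_p], so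
    it is [R_p]; a maximal proper overring is a valuation ring.
    (c) => (a): let [S] satisfy going-down and let [Q] be a prime of [S] over [p].  By
    going-down and (R1), [S_Q] lies in [R_q] for each height one prime [q] in [p].  As
    [R] is universally catenary, the intersection of these [R_q] is integral over
    [R_p].  Hence [S_Q] is integral over [R_p] for all [Q]; therefore only [Q] lies
    over [p], and for [Q] the maximal ideal, [S] itself is integral over [R_p]. *)

(** * Ideals of subrings and Zorn's lemma *)

(** Integrality of [S] over [loc p] alone would not make the prime over [p] unique, since an
    integral extension may have several. What counts is that [1 / t] is integral for each [t] of [S]
    outside [Q]; this is why integrality is stated for the whole localization of [S] at [Q], and for
    every [Q]. Universal catenarity enters through [{poly R}]: a failure of integrality becomes a
    prime of [{poly R}] at the top of a saturated chain of length two. Recognizing such chains takes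
    Krull's principal ideal theorem in [{poly R}], hence Hilbert's basis theorem. Only localizations
    of [R] are formed as rings; elsewhere fractions or saturated ideals stand for them. *)

Section SetLemmas.
Variable T : Type.
Implicit Types A B C : T -> Prop.

Lemma subs_refl A : subs A A. Proof. by []. Qed.

Lemma subs_trans A B C : subs A B -> subs B C -> subs A C.
Proof. by move=> AB BC x /AB /BC. Qed.

Lemma subs_anti A B : subs A B -> subs B A -> seteq A B.
Proof. by move=> AB BA x; split=> [/AB|/BA]. Qed.

Lemma seteq_sym A B : seteq A B -> seteq B A.
Proof. by move=> AB x; split=> /AB. Qed.

Lemma seteq_trans A B C : seteq A B -> seteq B C -> seteq A C.
Proof. by move=> AB BC x; split=> [/AB /BC|/BC /AB]. Qed.

Lemma seteqE A B : seteq A B -> A = B.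
Proof. by move=> AB; apply/funext => x; apply/propext. Qed.

Lemma not_subs A B : ~ subs A B -> exists x, A x /\ ~ B x.
Proof.
move=> AB; apply: contrapT => H; apply: AB => x Ax.
by apply: contrapT => Bx; apply: H; exists x.
Qed.

(** [Zorn_bigcup] also covers the empty chain, so it is applied to the sets [X] whose union with
    [A0] satisfies [P]; the empty union then gives [A0] itself. *)
Lemma zorn_union (P : (T -> Prop) -> Prop) A0 : P A0 ->
  (forall F : (T -> Prop) -> Prop, subs F P -> (exists A, F A) ->
     (forall A B, F A -> F B -> subs A B \/ subs B A) ->
     P (fun x => exists A, F A /\ A x)) ->
  exists M, [/\ P M, subs A0 M & forall B, P B -> subs M B -> subs B M].
Proof.
move=> PA0 Pchain; pose P' (X : set T) := P (fun x => A0 x \/ X x).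
have [|M [PM Mmax]] := @Zorn_bigcup T P'.
  move=> F FP' Ftot; rewrite /P'.
  pose F' (Y : T -> Prop) := exists X, [\/ Y = A0 | F X /\ Y = fun x => A0 x \/ X x].
  have : P (fun x => exists A, F' A /\ A x).
    apply: Pchain.
    - by move=> Y [X [->|[FX ->]]] //; apply: FP'.
    - by exists A0, A0; left.
    - move=> A B [X [->|[FX ->]]] [Y [->|[FY ->]]]; try by [left|left=> x; left|right=> x; left].
      by have [XY|YX] := Ftot X Y FX FY; [left|right] => x [?|Xx];
         [left|right; apply: XY|left|right; apply: YX].
  congr P; apply/funext => x; apply/propext; split.
    by move=> [A [[X [->|[FX ->]]]]]; [left|move=> [|Xx]; [left|right; exists X]].
  move=> [A0x|[X FX Xx]]; first by exists A0; split=> //; exists A0; left.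
  by exists (fun x => A0 x \/ X x); split; [exists X; right|right].
exists (fun x => A0 x \/ M x); split=> //; first by move=> x; left.
move=> B PB MB x Bx; apply: contrapT => nx.
apply: (Mmax B); last first.
  rewrite /P'; have -> // : (fun x => A0 x \/ B x) = B.
  apply/funext => t; apply/propext; split=> [[A0t|//]|]; last by right.
  by apply: MB; left.
split; last by move=> BM; apply: nx; right; apply: BM.
by move=> t Mt; apply: MB; right.
Qed.

End SetLemmas.

Section Ideals.
Variable T : comPzRingType.
Implicit Types (S I J P Q : T -> Prop).

Lemma fullset_subring : is_subring (@fullset T).
Proof. by []. Qed.

Lemma subring1 S : is_subring S -> S 1. Proof. by case. Qed.
Lemma subringB S x y : is_subring S -> S x -> S y -> S (x - y).
Proof. by case=> _ + _; apply. Qed.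
Lemma subringM S x y : is_subring S -> S x -> S y -> S (x * y).
Proof. by case=> _ _; apply. Qed.
Lemma subring0 S : is_subring S -> S 0.
Proof. by move=> hS; rewrite -(subrr 1); apply: subringB => //; apply: subring1. Qed.
Lemma subringN S x : is_subring S -> S x -> S (- x).
Proof. by move=> hS Sx; rewrite -sub0r; apply: subringB => //; apply: subring0. Qed.
Lemma subringD S x y : is_subring S -> S x -> S y -> S (x + y).
Proof. by move=> hS Sx Sy; rewrite -[y]opprK; apply: subringB => //; apply: subringN. Qed.
Lemma subringX S x n : is_subring S -> S x -> S (x ^+ n).
Proof.
move=> hS Sx; elim: n => [|n IH]; first by rewrite expr0; apply: subring1.
by rewrite exprS; apply: subringM.
Qed.
Lemma subring_sum S (n : nat) (F : 'I_n -> T) :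
  is_subring S -> (forall i, S (F i)) -> S (\sum_i F i).
Proof.
move=> hS SF; elim/big_ind: _ => //; first exact: subring0.
by move=> x y; apply: subringD.
Qed.

Lemma idealS S I x : ideal_in S I -> I x -> S x.
Proof. by case=> + _ _ _; apply. Qed.
Lemma ideal0 S I : ideal_in S I -> I 0. Proof. by case. Qed.
Lemma idealD S I x y : ideal_in S I -> I x -> I y -> I (x + y).
Proof. by case=> _ _ + _; apply. Qed.
Lemma idealM S I a x : ideal_in S I -> S a -> I x -> I (a * x).
Proof. by case=> _ _ _; apply. Qed.
Lemma ideal_mulr S I a x : ideal_in S I -> S a -> I x -> I (x * a).
Proof. by rewrite mulrC; apply: idealM. Qed.
Lemma idealN S I x : is_subring S -> ideal_in S I -> I x -> I (- x).
Proof.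
move=> hS hI Ix; rewrite -mulN1r; apply: (idealM hI) => //.
by apply: subringN => //; apply: subring1.
Qed.
Lemma idealB S I x y : is_subring S -> ideal_in S I -> I x -> I y -> I (x - y).
Proof. by move=> hS hI Ix Iy; apply: (idealD hI) => //; apply: (idealN hS hI). Qed.
Lemma ideal1 S I : ideal_in S I -> I 1 -> subs S I.
Proof. by move=> hI I1 x Sx; rewrite -[x]mulr1; apply: (idealM hI). Qed.

Lemma prime_ideal S P : prime_in S P -> ideal_in S P. Proof. by case. Qed.
Lemma prime1 S P : prime_in S P -> ~ P 1. Proof. by case. Qed.
Lemma primeM S P x y : prime_in S P -> S x -> S y -> P (x * y) -> P x \/ P y.
Proof. by case=> _ _; apply. Qed.
Lemma primeMn S P x y : prime_in S P -> S x -> S y -> ~ P x -> ~ P y -> ~ P (x * y).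
Proof. by move=> hP Sx Sy Px Py /(primeM hP Sx Sy) []. Qed.
Lemma primeX S P x n : is_subring S -> prime_in S P -> S x -> P (x ^+ n) -> P x.
Proof.
move=> hS hP Sx; elim: n => [|n IH]; first by rewrite expr0 => /(prime1 hP).
by rewrite exprS => /(primeM hP Sx) []//; apply: subringX.
Qed.

Lemma ideal_zero S : is_subring S -> ideal_in S (fun x => x = 0).
Proof.
move=> hS; split=> // [x ->|x y -> ->|a x _ ->]; rewrite ?addr0 ?mulr0 //.
exact: subring0.
Qed.

Definition adjoin S I a : T -> Prop := fun b => exists c r, [/\ I c, S r & b = c + r * a].

Lemma adjoin_ideal S I a : is_subring S -> ideal_in S I -> S a -> ideal_in S (adjoin S I a).
Proof.
move=> hS hI Sa; split.
- move=> x [c [r [Ic Sr ->]]]; apply: subringD => //; first exact: (idealS hI Ic).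
  exact: subringM.
- by exists 0, 0; rewrite mul0r addr0; split=> //; [apply: (ideal0 hI)|apply: subring0].
- move=> x y [c [r [Ic Sr ->]]] [d [t [Id St ->]]]; exists (c + d), (r + t).
  by rewrite mulrDl addrACA; split=> //; [apply: (idealD hI)|apply: subringD].
- move=> b x Sb [c [r [Ic Sr ->]]]; exists (b * c), (b * r).
  by rewrite mulrDr mulrA; split=> //; [apply: (idealM hI)|apply: subringM].
Qed.

Lemma adjoin_subs S I a : is_subring S -> subs I (adjoin S I a).
Proof. by move=> hS x Ix; exists x, 0; rewrite mul0r addr0; split=> //; apply: subring0. Qed.

Lemma adjoin_mem S I a : is_subring S -> ideal_in S I -> adjoin S I a a.
Proof.
by move=> hS hI; exists 0, 1; rewrite mul1r add0r; split=> //; [apply: (ideal0 hI)|apply: subring1].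
Qed.

Lemma ideal_chain_union S (F : (T -> Prop) -> Prop) :
  subs F (ideal_in S) -> (exists A, F A) ->
  (forall A B, F A -> F B -> subs A B \/ subs B A) ->
  ideal_in S (fun x => exists A, F A /\ A x).
Proof.
move=> FI [A0 FA0] Ftot; split.
- by move=> x [A [/FI hA Ax]]; apply: (idealS hA).
- by exists A0; split=> //; have /ideal0 := FI _ FA0.
- move=> x y [A [FA Ax]] [B [FB By]].
  have [AB|BA] := Ftot A B FA FB.
    by exists B; split=> //; apply: (idealD (FI _ FB)) => //; apply: AB.
  by exists A; split=> //; apply: (idealD (FI _ FA)) => //; apply: BA.
- by move=> a x Sa [A [FA Ax]]; exists A; split=> //; apply: (idealM (FI _ FA)).
Qed.

(** An ideal [P] maximal among those disjoint from [D] is prime: if [x] and [y] are outside [P],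
    then [P + Sx] and [P + Sy] both meet [D], and the product of the two common elements would lie
    in [P] if [x * y] did. *)
Lemma exists_prime_disjoint S I (D : T -> Prop) :
  is_subring S -> ideal_in S I -> D 1 ->
  (forall x y, D x -> D y -> D (x * y)) -> (forall x, I x -> ~ D x) ->
  exists P, [/\ prime_in S P, subs I P & forall x, P x -> ~ D x].
Proof.
move=> hS hI D1 DM ID.
have [||P [[hP PD] IP Pmax]] :=
  @zorn_union _ (fun J => ideal_in S J /\ forall x, J x -> ~ D x) I; first by [].
  move=> F FP [A0 FA0] Ftot; split; last by move=> x [A [/FP[_ AD] Ax]]; apply: AD.
  by apply: ideal_chain_union Ftot => //; [move=> A /FP[]|exists A0].
exists P; split=> //; split=> //; first by move=> /PD.
have key x : S x -> ~ P x -> exists c r, [/\ P c, S r & D (c + r * x)].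
  move=> Sx Px; apply: contrapT => H; apply: Px.
  apply: (Pmax (adjoin S P x)); last exact: adjoin_mem.
    split; first exact: adjoin_ideal.
    by move=> _ [c [r [Pc Sr ->]]] Dx; apply: H; exists c, r.
  exact: adjoin_subs.
move=> x y Sx Sy Pxy; apply: contrapT => /not_orP [nPx nPy].
have [c [r [Pc Sr D1']]] := key _ Sx nPx.
have [d [t [Pd St D2']]] := key _ Sy nPy.
apply: (PD _ _ (DM _ _ D1' D2')).
rewrite mulrDl; apply: (idealD hP).
  apply: (ideal_mulr hP) => //; apply: subringD => //; first exact: (idealS hP Pd).
  exact: subringM.
rewrite mulrDr; apply: (idealD hP).
  by apply: (idealM hP) => //; apply: subringM.
by rewrite mulrACA; apply: (idealM hP) => //; apply: subringM.
Qed.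

Lemma exists_prime_over S I : is_subring S -> ideal_in S I -> ~ I 1 ->
  exists P, prime_in S P /\ subs I P.
Proof.
move=> hS hI I1; have [|||||P [hP IP _]] := @exists_prime_disjoint S I (fun x => x = 1) => //.
- by move=> x y -> ->; rewrite mulr1.
- by move=> x Ix x1; apply: I1; rewrite -x1.
by exists P.
Qed.

Lemma exists_maximal_over S I : is_subring S -> ideal_in S I -> ~ I 1 ->
  exists M, maximal_in S M /\ subs I M.
Proof.
move=> hS hI I1.
have [||M [[hM M1] IM Mmax]] := @zorn_union _ (fun J => ideal_in S J /\ ~ J 1) I; first by [].
  move=> F FP [A0 FA0] Ftot; split; last by move=> [A [/FP[_ AD] Ax]]; apply: AD.
  by apply: ideal_chain_union Ftot => //; [move=> A /FP[]|exists A0].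
exists M; split=> //; split=> // J hJ J1 MJ; apply: subs_anti => //; exact: Mmax.
Qed.

Lemma maximal_prime S M : is_subring S -> maximal_in S M -> prime_in S M.
Proof.
move=> hS [hM M1 Mmax]; have [P [hP MP]] := exists_prime_over hS hM M1.
by have /seteqE <- := Mmax P (prime_ideal hP) (prime1 hP) MP.
Qed.

Lemma exists_minimal_prime I Q : prime_in fullset Q -> subs I Q ->
  exists P, [/\ prime_in fullset P, subs I P, subs P Q &
    forall P', prime_in fullset P' -> subs I P' -> subs P' P -> subs P P'].
Proof.
(* Zorn's lemma yields maximal sets, so it is applied to complements of primes: the union of a chain
   of these is the complement of an intersection of a chain of primes, which is prime. *)
move=> hQ IQ; pose C (X : T -> Prop) := fun x => ~ X x.
have CC X : C (C X) = X.
  by apply/funext => x; apply/propext; split=> [/contrapT|Xx /(_ Xx)].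
have Csub X Y : subs X Y -> subs (C Y) (C X) by move=> XY x nYx /XY.
have [||M [[hM IM] QM Mmax]] :=
  @zorn_union _ (fun X => prime_in fullset (C X) /\ subs I (C X)) (C Q); first by rewrite CC.
  move=> F FP [A0 FA0] Ftot; split; last first.
    by move=> x Ix [A [/FP [_ IA]]]; apply: IA.
  split.
  - split=> //.
    + by move=> [A [/FP[/prime_ideal/ideal0 hA _]]].
    + move=> x y Cx Cy [A [FA Axy]]; have [hA _] := FP _ FA.
      by have := @idealD _ _ x y (prime_ideal hA); apply=> // ?; [apply: Cx|apply: Cy]; exists A.
    + move=> a x _ Cx [A [FA Axy]]; have [hA _] := FP _ FA.
      by have := @idealM _ _ a x (prime_ideal hA); apply=> // ?; apply: Cx; exists A.
  - by move=> C1; have [hA _] := FP _ FA0; apply: (prime1 hA) => ?; apply: C1; exists A0.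
  - move=> x y _ _ Cxy; apply: contrapT => /not_orP [/contrapT [A [FA Ax]] /contrapT [B [FB By]]].
    have [hA _] := FP _ FA; have [hB _] := FP _ FB.
    have [AB|BA] := Ftot A B FA FB.
      have [||Bxy|/(_ (AB _ Ax))|/(_ By)] := @primeM _ _ x y hB => //.
      by apply: contrapT => nB; apply: Cxy; exists B.
    have [||Axy|/(_ Ax)|/(_ (BA _ By))] := @primeM _ _ x y hA => //.
    by apply: contrapT => nA; apply: Cxy; exists A.
exists (C M); split=> //; first by rewrite -[Q]CC; apply: Csub.
move=> P' hP' IP' P'M; rewrite -[P']CC; apply: (Csub _ _); apply: Mmax; first by rewrite CC.
by rewrite -[M]CC; apply: Csub.
Qed.

Lemma noetherian_max (Phi : (T -> Prop) -> Prop) I : noetherian_ring T ->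
  ideal_in fullset I -> Phi I ->
  exists M, [/\ ideal_in fullset M, Phi M &
    forall J, ideal_in fullset J -> Phi J -> subs M J -> subs J M].
Proof.
move=> noeth hI PI; apply: contrapT => H.
pose X := {J : T -> Prop | ideal_in fullset J /\ Phi J}.
have step (J : X) : {J' : X | subs (sval J) (sval J') /\ ~ subs (sval J') (sval J)}.
  case: J => J [hJ PJ] /=; apply: cid; apply: contrapT => HJ; apply: H.
  exists J; split=> // J' hJ' PJ' JJ'; apply: contrapT => J'J.
  by apply: HJ; exists (exist _ J' (conj hJ' PJ')).
pose c n := iter n (fun J : X => sval (step J)) (exist _ I (conj hI PI)).
have cS n : subs (sval (c n)) (sval (c n.+1)) /\ ~ subs (sval (c n.+1)) (sval (c n)).
  by rewrite /c iterS; case: (step _).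
have [||N HN] := noeth (fun n => sval (c n)).
- by move=> n; case: (svalP (c n)).
- by move=> n; case: (cS n).
by have [_] := cS N; apply; apply: HN.
Qed.

End Ideals.
Coercion prime_ideal : prime_in >-> ideal_in.

Lemma prime_preim (A B : comPzRingType) (f : {rmorphism A -> B}) (S Q : B -> Prop) :
  (forall a, S (f a)) -> prime_in S Q -> prime_in fullset (fun a => Q (f a)).
Proof.
move=> Sf hQ; split.
- split=> //.
  + by rewrite rmorph0; apply: (ideal0 hQ).
  + by move=> a b Qa Qb; rewrite rmorphD; apply: (idealD hQ).
  + by move=> a b _ Qb; rewrite rmorphM; apply: (idealM hQ (Sf a)).
- by rewrite rmorph1; apply: (prime1 hQ).
- by move=> a b _ _; rewrite rmorphM; apply: (primeM hQ (Sf a) (Sf b)).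
Qed.

Lemma prime_zero (A : idomainType) (S : A -> Prop) :
  is_subring S -> prime_in S (fun x => x = 0).
Proof.
move=> hS; split; first exact: ideal_zero.
- by apply/eqP; rewrite oner_eq0.
- by move=> x y _ _ /eqP; rewrite mulf_eq0 => /orP [] /eqP; [left|right].
Qed.

Lemma nonunit_proper (F : fieldType) (S : F -> Prop) x :
  is_subring S -> S x -> ~ S x^-1 -> exists I, [/\ ideal_in S I, ~ I 1 & I x].
Proof.
move=> hS Sx Sxi; have h0 := ideal_zero hS.
exists (adjoin S (fun y => y = 0) x); split; [exact: adjoin_ideal| |exact: adjoin_mem].
have x0 : x != 0 by apply: contra_not_neq Sxi => ->; rewrite invr0; apply: subring0.
move=> [c [r [-> Sr]]]; rewrite add0r => E; apply: Sxi.
by rewrite -[x^-1]mul1r E mulfK.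
Qed.

(** * Krull's principal ideal theorem and chains of primes *)

Section Krull.
Variable T : comPzRingType.
Hypothesis noeth : noetherian_ring T.
Implicit Types (I J P Q p q : T -> Prop).
Local Notation ideal := (@ideal_in T fullset).
Local Notation prime := (@prime_in T fullset).

(* Ideals of the localization at [q] are encoded by the [q]-saturated ideals of [T]. *)
Definition saturated q I := forall s b, ~ q s -> I (s * b) -> I b.
Definition saturation q I := fun b => exists s, ~ q s /\ I (s * b).

Lemma saturation_ideal q I : prime q -> ideal I -> ideal (saturation q I).
Proof.
move=> hq hI; split=> //.
- by exists 1; rewrite mulr0; split; [apply: (prime1 hq)|apply: (ideal0 hI)].
- move=> x y [s [qs Isx]] [t [qt Ity]]; exists (s * t); split; first exact: (primeMn hq).
  rewrite mulrDr; apply: (idealD hI); last by rewrite -mulrA; apply: (idealM hI).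
  by rewrite mulrAC; apply: (ideal_mulr hI).
- by move=> a x _ [s [qs Isx]]; exists s; split=> //; rewrite mulrCA; apply: (idealM hI).
Qed.

Lemma saturation_saturated q I : prime q -> saturated q (saturation q I).
Proof.
move=> hq s b qs [t [qt Itsb]]; exists (t * s); rewrite -mulrA; split=> //.
exact: (primeMn hq).
Qed.

Lemma saturation_subs q I : prime q -> subs I (saturation q I).
Proof. by move=> hq x Ix; exists 1; rewrite mul1r; split=> //; apply: (prime1 hq). Qed.

(* A maximal annihilator [(I : s)] is prime, as in the existence of associated primes. *)
Lemma exists_prime_colon I : ideal I -> ~ I 1 ->
  exists s, ~ I s /\ prime (fun a => I (a * s)).
Proof.
move=> hI I1; pose colon s a := I (a * s).
have colon_ideal s : ideal (colon s).
  split=> //.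
  - by rewrite /colon mul0r; apply: (ideal0 hI).
  - by move=> x y Ix Iy; rewrite /colon mulrDl; apply: (idealD hI).
  - by move=> a x _ Ix; rewrite /colon -mulrA; apply: (idealM hI).
have [|M [hM [s [Is MsE]] Mmax]] :=
  noetherian_max (Phi := fun A => exists s, ~ I s /\ A = colon s) noeth (colon_ideal 1).
  by exists 1.
subst M; exists s; split=> //; split=> //; first by rewrite mul1r.
move=> a b _ _ Iabs; apply: contrapT => /not_orP [nIa nIb]; apply: nIa.
apply: (Mmax (colon (b * s))) => //; last by rewrite /colon mulrA.
  by exists (b * s).
by move=> x; rewrite /colon mulrCA => Ix; apply: (idealM hI).
Qed.

(** In classical terms, the localization of [T / I0] at [q] is Artinian. Noetherian induction
    replaces the theory of length: for a maximal counterexample [I], a prime colon [(I : s)] must be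
    [q], so adding [s] enlarges [I] by a copy of the residue field. A descending chain over [I]
    either keeps [s] forever or is controlled by its sums with [s]. *)
Lemma saturated_dcc q I0 : prime q -> ideal I0 -> saturated q I0 ->
  (forall P, prime P -> subs I0 P -> subs P q -> subs q P) ->
  forall J : nat -> T -> Prop, (forall n, ideal (J n)) -> (forall n, saturated q (J n)) ->
    (forall n, subs I0 (J n)) -> (forall n, subs (J n.+1) (J n)) ->
    exists N, forall n, (N <= n)%N -> subs (J N) (J n).
Proof.
move=> hq hI0 sI0 minq.
pose dcc I := forall J : nat -> T -> Prop,
  (forall n, ideal (J n)) -> (forall n, saturated q (J n)) ->
  (forall n, subs I (J n)) -> (forall n, subs (J n.+1) (J n)) ->
  exists N, forall n, (N <= n)%N -> subs (J N) (J n).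
apply: contrapT => ndcc.
have [|I [hI [I0I sI nI] Imax]] :=
  noetherian_max (Phi := fun I => [/\ subs I0 I, saturated q I & ~ dcc I]) noeth hI0.
  by split.
apply: (nI) => J hJ sJ IJ decJ.
have Jle m n : (m <= n)%N -> subs (J n) (J m).
  move=> /subnK <-; elim: (n - m)%N => //= k IH.
  by apply: subs_trans (decJ _) IH.
have [I1|nI1] := pselect (I 1).
  by exists 0%N => n _ x _; apply: (ideal1 (hJ n)) => //; apply: IJ.
have [s [Is hM]] := exists_prime_colon hI nI1.
have Iqs a : q a -> I (a * s).
  apply: (minq _ hM).
    by move=> x /I0I Ix; rewrite mulrC; apply: (idealM hI).
  by move=> x Ix; apply: contrapT => qx; apply: Is; apply: (sI x).
pose I' := saturation q (adjoin fullset I s).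
have hI' : ideal (adjoin fullset I s) by apply: adjoin_ideal.
have dccI' : dcc I'.
  apply: contrapT => nI'; apply: Is; apply: (Imax I').
  - exact: saturation_ideal.
  - split=> //; last exact: saturation_saturated.
    by apply: subs_trans I0I (subs_trans (adjoin_subs _ _) (saturation_subs hq)).
  - by apply: subs_trans (adjoin_subs _ _) (saturation_subs hq).
  - by apply: saturation_subs => //; apply: adjoin_mem.
have [Js|/existsNP [N2 Js]] := pselect (forall n, J n s).
  apply: dccI' => // n x [t [qt [c [r [Ic _ E]]]]].
  apply: (sJ n t) => //; rewrite E; apply: (idealD (hJ n)); first exact: IJ.
  exact: (idealM (hJ n)).
pose J' n := saturation q (adjoin fullset (J n) s).
have hJ' n : ideal (adjoin fullset (J n) s) by apply: adjoin_ideal.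
have [||||N1 HN1] := dccI' J'.
- by move=> n; apply: saturation_ideal.
- by move=> n; apply: saturation_saturated.
- move=> n x [t [qt [c [r [Ic _ E]]]]]; exists t; split=> //; exists c, r; split=> //.
  exact: IJ.
- move=> n x [t [qt [c [r [Ic _ E]]]]]; exists t; split=> //; exists c, r; split=> //.
  exact: decJ.
exists (maxn N1 N2) => n; rewrite geq_max => /andP [N1n N2n] b Jb.
have [|t [qt [c [r [Jc _ E]]]]] := HN1 n N1n b.
  by apply: saturation_subs => //; apply: adjoin_subs => //; apply: Jle Jb; apply: leq_maxl.
have JN2s : ~ J (maxn N1 N2) s by move=> Jm; apply: Js; apply: Jle Jm; apply: leq_maxr.
have Jrs : J (maxn N1 N2) (r * s).
  have -> : r * s = t * b - c by rewrite E addrC addKr.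
  apply: (idealB _ (hJ _)) => //; first exact: (idealM (hJ _)).
  by apply: Jle Jc; rewrite geq_max N1n.
(* If [r] were outside [q], saturation would put [s] in the chain. So [r] is in [q], and [r * s] is
   already in [I]. *)
have qr : q r by apply: contrapT => qr; apply: JN2s; apply: (sJ _ r).
apply: (sJ n t) => //; rewrite E; apply: (idealD (hJ n)) => //.
by apply: IJ; apply: Iqs.
Qed.

(** Nakayama's lemma for [M = N + z M] at [q], without determinants. A saturated [H] maximal among
    the proper ones between [N] and [M] makes [M / H] cyclic at [q], with some generator [g]; then
    [s' * s - z * t], a unit at [q], sends [g] into [H]. *)
Lemma nakayama_saturated q M N z : prime q -> q z -> ideal M -> ideal N ->
  saturated q M -> saturated q N -> subs N M ->
  (forall b, M b -> exists s c m, [/\ ~ q s, N c, M m & s * b = c + m * z]) ->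
  subs M N.
Proof.
move=> hq qz hM hN sM sN NM hgen; apply: contrapT => nMN.
have [|H [hH [sH NH HM nMH] Hmax]] :=
  noetherian_max (Phi := fun H => [/\ saturated q H, subs N H, subs H M & ~ subs M H]) noeth hN.
  by split.
have [g [Mg nHg]] := not_subs nMH.
have hH' : ideal (adjoin fullset H g) by apply: adjoin_ideal.
have Mgen : subs M (saturation q (adjoin fullset H g)).
  apply: contrapT => nM; apply: nHg.
  apply: (Hmax (saturation q (adjoin fullset H g))).
  - exact: saturation_ideal.
  - split=> //; first exact: saturation_saturated.
      by apply: subs_trans NH (subs_trans (adjoin_subs _ _) (saturation_subs hq)).
    move=> x [t [qt [c [r [Hc _ E]]]]]; apply: (sM t) => //; rewrite E.
    by apply: (idealD hM); [apply: HM|apply: (idealM hM)].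
  - by apply: subs_trans (adjoin_subs _ _) (saturation_subs hq).
  - by apply: saturation_subs => //; apply: adjoin_mem.
have [s [n [m [qs Nn Mm Eg]]]] := hgen _ Mg.
have [s' [qs' [h [t [Hh _ Em]]]]] := Mgen _ Mm.
apply: nHg; apply: (sH (s' * s - z * t)).
  move=> qsz; apply: (primeMn hq _ _ qs' qs) => //.
  by rewrite -(subrK (z * t) (s' * s)); apply: (idealD hq) => //; apply: (ideal_mulr hq).
have -> : (s' * s - z * t) * g = s' * n + z * h.
  have -> : h = s' * m - t * g by rewrite Em addrK.
  have -> : n = s * g - m * z by rewrite Eg addrK.
  ring.
by apply: (idealD hH); apply: (idealM hH) => //; apply: NH.
Qed.

(* Krull's principal ideal theorem in [T / p].  The chain [J n] plays the role of
   the symbolic powers of [q0]: it is the contraction of [y ^+ n] extended to the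
   localization at [q0], modulo [p]. *)
Lemma principal_ideal_theorem p z q q0 : prime p -> prime q -> subs p q -> q z ->
  (forall P, prime P -> subs p P -> P z -> subs P q -> subs q P) ->
  prime q0 -> subs p q0 -> subs q0 q -> subs q0 p \/ subs q q0.
Proof.
move=> hp hq pq qz minq hq0 pq0 q0q; apply: contrapT => /not_orP [nq0p nqq0].
have [y [q0y npy]] := not_subs nq0p.
have nq0z : ~ q0 z by move=> q0z; apply: nqq0; apply: minq.
pose J n b := exists s t, ~ q0 s /\ p (s * b - t * y ^+ n).
have hJ n : ideal (J n).
  split=> //.
  - exists 1, 0; split; first exact: (prime1 hq0).
    by rewrite mulr0 mul0r subr0; apply: (ideal0 hp).
  - move=> a b [s [t [qs H1]]] [s' [t' [qs' H2]]].
    exists (s * s'), (s' * t + s * t'); split; first exact: (primeMn hq0).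
    have -> : s * s' * (a + b) - (s' * t + s * t') * y ^+ n =
      s' * (s * a - t * y ^+ n) + s * (s' * b - t' * y ^+ n) by ring.
    by apply: (idealD hp); apply: (idealM hp).
  - move=> a b _ [s [t [qs H1]]]; exists s, (a * t); split=> //.
    have -> : s * (a * b) - a * t * y ^+ n = a * (s * b - t * y ^+ n) by ring.
    exact: (idealM hp).
have sJ0 n : saturated q0 (J n).
  move=> s b qs [s' [t [qs' H]]]; exists (s' * s), t; split; first exact: (primeMn hq0).
  by rewrite -mulrA.
have sJ n : saturated q (J n) by move=> s b qs; apply: sJ0 => /q0q.
have pJ n : subs p (J n).
  move=> x px; exists 1, 0; split; first exact: (prime1 hq0).
  by rewrite mul1r mul0r subr0.
have decJ n : subs (J n.+1) (J n).
  move=> x [s [t [qs H]]]; exists s, (t * y); split=> //.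
  by rewrite -mulrA -exprS.
have hJz n : ideal (adjoin fullset (J n) z) by apply: adjoin_ideal.
have [|||||||N HN] := @saturated_dcc q (saturation q (adjoin fullset p z)) hq _ _ _
  (fun n => saturation q (adjoin fullset (J n) z)).
- by apply: saturation_ideal => //; apply: adjoin_ideal => //; apply: prime_ideal.
- exact: saturation_saturated.
- move=> P hP IP Pq; apply: minq => //.
    move=> x px; apply: IP; apply: saturation_subs => //.
    by apply: adjoin_subs.
  by apply: IP; apply: saturation_subs => //; apply: adjoin_mem => //; apply: prime_ideal.
- by move=> n; apply: saturation_ideal.
- by move=> n; apply: saturation_saturated.
- move=> n x [t [qt [c [r [pc _ E]]]]]; exists t; split=> //; exists c, r; split=> //.
  exact: pJ.
- move=> n x [t [qt [c [r [Jc _ E]]]]]; exists t; split=> //; exists c, r; split=> //.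
  exact: decJ.
(* Stationarity writes an element of [J N], up to a factor outside [q], as an element of [J N.+1]
   plus [r * z]. As [z] is outside [q0], the coefficient [r] is itself in [J N], and Nakayama's
   lemma applies. *)
have JJ : subs (J N) (J N.+1).
  apply: (nakayama_saturated hq qz) => // b Jb.
  have [|s [qs [c [r [Jc _ E]]]]] := HN N.+1 (leqnSn N) b.
    by apply: saturation_subs => //; apply: adjoin_subs.
  exists s, c, r; split=> //; apply: (sJ0 N z) => //.
  have -> : z * r = s * b - c by rewrite E addrC addKr mulrC.
  apply: (idealB _ (hJ N)) => //; first exact: (idealM (hJ N)).
  exact: decJ.
(* For [y ^+ N] this says that [(s - t * y) * y ^+ N] is in [p] with [s] outside [q0], which is
   impossible since [y] is in [q0] but not in [p]. *)
have [|s [t [q0s H]]] := JJ (y ^+ N).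
  exists 1, 1; split; first exact: (prime1 hq0).
  by rewrite subrr; apply: (ideal0 hp).
have : p ((s - t * y) * y ^+ N) by rewrite mulrBl -mulrA -exprS.
case/(primeM hp) => // [/pq0 q0sty|/(primeX (@fullset_subring _) hp)]; last by move=> /(_ I) /npy.
apply: q0s; rewrite -(subrK (t * y) s); apply: (idealD hq0) => //.
exact: (idealM hq0).
Qed.

Definition covers p q := [/\ prime p, prime q, subs p q, ~ subs q p &
  forall Q, prime Q -> subs p Q -> subs Q q -> subs Q p \/ subs q Q].

Lemma minimal_over_covers p z q : prime p -> prime q -> subs p q -> q z -> ~ p z ->
  (forall P, prime P -> subs p P -> P z -> subs P q -> subs q P) -> covers p q.
Proof.
move=> hp hq pq qz npz minq; split=> //; first by move=> qp; apply: npz; apply: qp.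
by move=> Q hQ pQ Qq; apply: (principal_ideal_theorem hp hq pq qz).
Qed.

Lemma exists_minimal_over p z Q : prime p -> prime Q -> subs p Q -> Q z ->
  exists q, [/\ prime q, subs p q, q z, subs q Q &
    forall P, prime P -> subs p P -> P z -> subs P q -> subs q P].
Proof.
move=> hp hQ pQ Qz.
have [|q [hq Iq qQ minq]] := @exists_minimal_prime _ (adjoin fullset p z) Q hQ.
  move=> x [c [r [pc _ ->]]]; apply: (idealD hQ); first exact: pQ.
  exact: (idealM hQ).
exists q; split=> //.
- by move=> x px; apply: Iq; apply: adjoin_subs.
- by apply: Iq; apply: adjoin_mem => //; apply: prime_ideal.
move=> P hP pP Pz; apply: minq => // x [c [r [pc _ ->]]].
by apply: (idealD hP); [apply: pP|apply: (idealM hP)].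
Qed.

Lemma exists_cover p q : prime p -> prime q -> subs p q -> ~ subs q p ->
  exists p', covers p p' /\ subs p' q.
Proof.
move=> hp hq pq nqp; have [z [qz npz]] := not_subs nqp.
have [p' [hp' pp' p'z p'q minp']] := exists_minimal_over hp hq pq qz.
by exists p'; split=> //; apply: minimal_over_covers p'z npz minp'.
Qed.

(** An inductive form of [saturated_chain], suited to gluing chains end to end before their lengths
    are compared. *)
Inductive cover_chain : (T -> Prop) -> (T -> Prop) -> nat -> Prop :=
| cover_chain0 p : prime p -> cover_chain p p 0
| cover_chainS p p' q n : covers p p' -> cover_chain p' q n -> cover_chain p q n.+1.

Lemma cover_chain_cat p q r m n :
  cover_chain p q m -> cover_chain q r n -> cover_chain p r (m + n).
Proof.
by elim=> // p0 p' q0 k cov _ IH /IH; apply: cover_chainS cov.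
Qed.

Lemma cover_chain_saturated p q n : cover_chain p q n -> exists c, saturated_chain p q n c.
Proof.
elim=> [p0 hp0|p0 p' q0 k [hp0 hp' sub nsub cov] _ [c [c0 cn hc cS cov']]].
  by exists (fun=> p0); split=> // i; rewrite ltn0.
exists (fun i => if i is j.+1 then c j else p0); split=> //.
- by case.
- move=> [_|i]; last by rewrite ltnS; apply: cS.
  by rewrite (seteqE c0).
- move=> [_|i]; last by rewrite ltnS; apply: cov'.
  rewrite (seteqE c0) => Q hQ pQ Qp'.
  by have [Qp|p'Q] := cov Q hQ pQ Qp'; [left|right]; apply: subs_anti.
Qed.

Lemma exists_cover_chain p q : prime p -> prime q -> subs p q ->
  exists n, cover_chain p q n.
Proof.
move=> hp hq pq; apply: contrapT => H.
have [|P [_ [hP Pq HP] Pmax]] := noetherian_max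
  (Phi := fun P => [/\ prime P, subs P q & ~ exists n, cover_chain P q n]) noeth (prime_ideal hp).
  by split.
have [qP|nqP] := pselect (subs q P).
  by apply: HP; exists 0%N; rewrite (seteqE (subs_anti Pq qP)); apply: cover_chain0.
have [p' [cov p'q]] := exists_cover hP hq Pq nqP; have [_ hp' Pp' np'P _] := cov.
apply: HP; have [[n chn]|nch] := pselect (exists n, cover_chain p' q n).
  by exists n.+1; apply: cover_chainS chn.
by exfalso; apply: np'P; apply: Pmax => //; apply: prime_ideal.
Qed.

Lemma exists_cover_chain_gt0 p q : prime p -> prime q -> subs p q -> ~ subs q p ->
  exists n, cover_chain p q n.+1.
Proof.
move=> hp hq pq nqp; have [[|n] chn] := exists_cover_chain hp hq pq; last by exists n.
by case: _ _ {-1}_ / chn (erefl 0%N) nqp => // r _ _ [].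
Qed.

Lemma catenary_cover_chain p q m n : catenary_ring T -> prime p -> prime q -> subs p q ->
  cover_chain p q m -> cover_chain p q n -> m = n.
Proof.
move=> cat hp hq pq /cover_chain_saturated [c hc] /cover_chain_saturated [d hd].
exact: cat hc hd.
Qed.

End Krull.

(** * Hilbert's basis theorem *)

Section HilbertBasis.
Variable R : comNzRingType.

(** The coefficient ideals [lead d k] increase with [d] and with [k]. Their diagonal is stationary
    from some [N0] on, which settles every [d] from [N0] on; the finitely many smaller [d] are
    settled one at a time. Induction on the size then cancels leading terms. *)
Lemma noetherian_poly : noetherian_ring R -> noetherian_ring {poly R}.
Proof.
move=> noeth I hI incI.
have Ile m n : (m <= n)%N -> subs (I m) (I n).
  move=> /subnK <-; elim: (n - m)%N => //= k IH.
  by apply: subs_trans IH (incI _).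
pose lead d k c := exists f : {poly R}, [/\ I k f, (size f <= d.+1)%N & f`_d = c].
have hlead d k : ideal_in fullset (lead d k).
  split=> //.
  - by exists 0; rewrite size_poly0 coef0; split=> //; apply: (ideal0 (hI k)).
  - move=> x y [f [If sf <-]] [g [Ig sg <-]]; exists (f + g); rewrite coefD; split=> //.
      exact: (idealD (hI k)).
    by apply: leq_trans (size_polyD _ _) _; rewrite geq_max sf.
  - move=> a x _ [f [If sf <-]]; exists (a%:P * f); rewrite coefCM; split=> //.
      exact: (idealM (hI k)).
    by rewrite mul_polyC; apply: leq_trans (size_scale_leq _ _) sf.
have lead_k d k k' : (k <= k')%N -> subs (lead d k) (lead d k').
  by move=> kk' c [f [If sf fd]]; exists f; split=> //; apply: Ile If.
have lead_d d d' k : (d <= d')%N -> subs (lead d k) (lead d' k).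
  move=> dd' c [f [If sf fd]]; exists (f * 'X^(d' - d)); split.
  - exact: (ideal_mulr (hI k)).
  - apply: leq_trans (size_polyMleq _ _) _; rewrite size_polyXn addnS /=.
    by rewrite -(subnKC dd') addKn -addSn leq_add2r.
  - by rewrite coefMXn ltnNge leq_subr /= subKn.
have [||N0 HN0] := noeth (fun n => lead n n) => // [n|].
  by apply: subs_trans (lead_d _ _ _ (leqnSn n)) (lead_k _ _ _ (leqnSn n)).
have [M [N0M HM]] : exists M, (N0 <= M)%N /\
    forall d, (d < N0)%N -> forall m, (M <= m)%N -> subs (lead d m) (lead d M).
  elim: {2}N0 => [|b [M [N0M HM]]]; first by exists N0.
  have [||Nb HNb] := noeth (lead b) => // [n|]; first by apply: lead_k.
  exists (maxn M Nb); split=> [|d]; first by rewrite leq_max N0M.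
  rewrite ltnS leq_eqVlt => /orP [/eqP->|db] m; rewrite geq_max => /andP [Mm Nm].
    by apply: subs_trans (HNb m Nm) (lead_k _ _ _ (leq_maxr _ _)).
  by apply: subs_trans (HM d db m Mm) (lead_k _ _ _ (leq_maxl _ _)).
have {}HM d m : (M <= m)%N -> subs (lead d m) (lead d M).
  have [dN0|N0d] := ltnP d N0; first exact: HM.
  move=> Mm; apply: subs_trans (lead_k _ _ (maxn d m) (leq_maxr _ _)) _.
  apply: subs_trans (lead_d _ (maxn d m) _ (leq_maxl _ _)) _.
  apply: subs_trans (HN0 _ _) _; first by rewrite leq_max N0d.
  by apply: subs_trans (lead_d _ _ _ N0d) (lead_k _ _ _ N0M).
exists M => m Mm f; move: {2}(size f) (leqnn (size f)) => n.
elim: n f => [|n IH] f sf If.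
  by move: sf; rewrite leqn0 size_poly_eq0 => /eqP->; apply: (ideal0 (hI M)).
have [|g [Ig sg gn]] := HM n m Mm f`_n; first by exists f.
rewrite -(subrK g f); apply: (idealD (hI M)) => //; apply: IH; last first.
  by apply: (idealB _ (hI m)) => //; apply: Ile Ig.
apply/leq_sizeP => j; rewrite leq_eqVlt => /orP [/eqP<-|nj].
  by rewrite coefB gn subrr.
by rewrite coefB !nth_default ?subrr //; [apply: leq_trans sg nj|apply: leq_trans sf nj].
Qed.

End HilbertBasis.

(** * Localizations in the fraction field *)

Identity Coercion prime_of_primeR : primeR >-> prime_in.

Section Localization.
Variable R : idomainType.
Local Notation K := {fraction R}.
Local Notation "x %:F" := (@FracField.tofrac R x).
Implicit Types (p q : R -> Prop) (S P Q : K -> Prop) (x y : K) (a b c d : R).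

Lemma fracE x : exists a b, b != 0 /\ x = a%:F / b%:F.
Proof.
elim/quotW: x => r; exists \n_r, \d_r; split; first exact: denom_ratioP.
have dr := denom_ratioP r.
apply: (@mulIf _ (\d_r)%:F); first by rewrite tofrac_eq0.
rewrite divfK ?tofrac_eq0 //; unlock FracField.tofrac.
rewrite -[LHS]FracField.pi_mul; apply/eqmodP; rewrite /= FracField.equivfE /FracField.mulf.
by rewrite !numden_Ratio ?oner_neq0 ?mulr1 // mulrC.
Qed.

Lemma prime_neq0 p a : primeR p -> ~ p a -> a != 0.
Proof. by move=> hp pa; apply/eqP => a0; apply: pa; rewrite a0; apply: (ideal0 hp). Qed.

Lemma primeR_prod p a b : primeR p -> ~ p a -> ~ p b -> ~ p (a * b).
Proof. by move=> hp; apply: (primeMn hp). Qed.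

Lemma primeR_divr p a b c d : primeR p -> ~ p b -> ~ p d ->
  a%:F / b%:F = c%:F / d%:F -> a * d = c * b.
Proof.
move=> hp pb pd /eqP; rewrite eqr_div ?tofrac_eq0 ?(prime_neq0 hp) //.
by rewrite -!rmorphM tofrac_eq => /eqP.
Qed.

Lemma loc_tofrac p a : primeR p -> loc p a%:F.
Proof. by move=> hp; exists a, 1; rewrite rmorph1 divr1; split=> //; apply: (prime1 hp). Qed.

Lemma loc_inv p b : ~ p b -> loc p (b%:F)^-1.
Proof. by move=> pb; exists 1, b; rewrite rmorph1 mul1r. Qed.

Lemma loc_inv_tofrac p c : primeR p -> c != 0 -> loc p (c%:F)^-1 -> ~ p c.
Proof.
move=> hp c0 [a [b [pb /(congr1 (fun z => z * c%:F * b%:F))]]].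
rewrite mulVf ?tofrac_eq0 // mul1r mulrAC divfK ?tofrac_eq0 ?(prime_neq0 hp) //.
rewrite -rmorphM => /eqP; rewrite tofrac_eq => /eqP E pc; apply: pb; rewrite E.
exact: (idealM hp).
Qed.

Lemma loc_subring p : primeR p -> is_subring (loc p).
Proof.
move=> hp; split.
- by rewrite -(rmorph1 (@FracField.tofrac R)); apply: loc_tofrac.
- move=> _ _ [a [b [pb ->]]] [c [d [pd ->]]]; exists (a * d - c * b), (b * d).
  split; first exact: primeR_prod.
  by rewrite -mulNr addf_div ?tofrac_eq0 ?(prime_neq0 hp) // mulNr rmorphB !rmorphM.
- move=> _ _ [a [b [pb ->]]] [c [d [pd ->]]]; exists (a * c), (b * d).
  by rewrite mulf_div !rmorphM; split=> //; apply: primeR_prod.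
Qed.

Lemma loc_overring p : primeR p -> overring (loc p).
Proof. by move=> hp; split; [apply: loc_subring|move=> a; apply: loc_tofrac]. Qed.

Lemma loc_min p S : is_subring S -> (forall a, S a%:F) ->
  (forall b, ~ p b -> S (b%:F)^-1) -> subs (loc p) S.
Proof. by move=> hS RS pS _ [a [b [pb ->]]]; apply: subringM => //; apply: pS. Qed.

Lemma overring_loc p S : primeR p -> is_subring S -> subs (loc p) S -> overring S.
Proof. by move=> hp hS pS; split=> // a; apply: pS; apply: loc_tofrac. Qed.

Lemma prime_contr S Q : overring S -> prime_in S Q -> primeR (contrR Q).
Proof.
move=> [_ RS]; exact: (prime_preim (f := (@FracField.tofrac R : {rmorphism R -> K})) RS).
Qed.

Lemma contr_subs p S Q : primeR p -> subs (loc p) S -> prime_in S Q -> subs (contrR Q) p.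
Proof.
move=> hp pS hQ a Qa; apply: contrapT => pa; apply: (prime1 hQ).
rewrite -(@mulVf _ a%:F) ?tofrac_eq0 ?(prime_neq0 hp) //; apply: (idealM hQ) => //.
by apply: pS; apply: loc_inv.
Qed.

(** An element [a / b] of [loc p] differs from its numerator by a unit of [S], so inclusions on
    [loc p] can be tested on [R]. *)
Lemma loc_contr_subs p S Q Q' : is_subring S -> subs (loc p) S -> primeR p ->
  ideal_in S Q -> ideal_in S Q' -> subs (contrR Q) (contrR Q') ->
  forall x, loc p x -> Q x -> Q' x.
Proof.
move=> hS pS hp hQ hQ' QQ' _ [a [b [pb ->]]] Qab.
apply: (ideal_mulr hQ'); first by apply: pS; apply: loc_inv.
apply: QQ'; rewrite /contrR -[a%:F](@divfK _ b%:F) ?tofrac_eq0 ?(prime_neq0 hp) //.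
by apply: (ideal_mulr hQ) => //; apply: pS; apply: loc_tofrac.
Qed.

Definition loc_ext p q : K -> Prop := fun x => exists a b, [/\ q a, ~ p b & x = a%:F / b%:F].

Lemma loc_ext_contr p q : primeR p -> primeR q -> subs q p -> seteq (contrR (loc_ext p q)) q.
Proof.
move=> hp hq qp a; split; last first.
  by move=> qa; exists a, 1; rewrite rmorph1 divr1; split=> //; apply: (prime1 hp).
move=> [c [d [qc pd E]]]; have : q (a * d).
  suff -> : a * d = c by [].
  rewrite -[c]mulr1; apply: (@primeR_divr p) => //; first exact: (prime1 hp).
  by rewrite rmorph1 divr1.
by case/(primeM hq) => // /qp.
Qed.

Lemma loc_ext_prime p q : primeR p -> primeR q -> subs q p -> prime_in (loc p) (loc_ext p q).
Proof.
move=> hp hq qp; split.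
- split.
  + by move=> _ [a [b [_ pb ->]]]; exists a, b.
  + exists 0, 1; rewrite rmorph0 mul0r; split=> //; first exact: (ideal0 hq).
    exact: (prime1 hp).
  + move=> _ _ [a [b [qa pb ->]]] [c [d [qc pd ->]]]; exists (a * d + c * b), (b * d).
    split; [|exact: primeR_prod|].
      by apply: (idealD hq); apply: (ideal_mulr hq).
    by rewrite addf_div ?tofrac_eq0 ?(prime_neq0 hp) // rmorphD !rmorphM.
  + move=> _ _ [a [b [pb ->]]] [c [d [qc pd ->]]]; exists (a * c), (b * d).
    split; [exact: (idealM hq)|exact: primeR_prod|].
    by rewrite mulf_div !rmorphM.
- rewrite -(rmorph1 (@FracField.tofrac R)) => H.
  by apply: (prime1 hq); apply/(loc_ext_contr hp hq qp).
- move=> _ _ [a [b [pb ->]]] [c [d [pd ->]]]; rewrite mulf_div -!rmorphM.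
  move=> [e [f [qe pf]]] /(primeR_divr hp) E.
  have : q (a * c * f) by rewrite E //; [apply: (ideal_mulr hq)|apply: primeR_prod].
  case/(primeM hq) => // [/(primeM hq)[]// q1|/qp//]; [left|right].
    by exists a, b.
  by exists c, d.
Qed.

Lemma local_inv S M x : is_subring S ->
  (forall M', maximal_in S M' -> seteq M' M) -> S x -> ~ M x -> S x^-1.
Proof.
move=> hS Muniq Sx Mx; apply: contrapT => Sxi; apply: Mx.
have [I [hI I1 Ix]] := nonunit_proper hS Sx Sxi.
have [M' [hM' IM']] := exists_maximal_over hS hI I1.
by apply/(Muniq M' hM'); apply: IM'.
Qed.

Lemma perinormal_unibranched : perinormal R -> forall p, primeR p -> forall S : K -> Prop,
  is_subring S -> subs (loc p) S -> order_refl_bij (loc p) S -> seteq S (loc p).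
Proof.
move=> peri p hp S hS pS [surj _ refl]; have RS := overring_loc hp hS pS.
have sub Q1 Q2 : prime_in S Q1 -> prime_in S Q2 -> subs (contrR Q1) (contrR Q2) -> subs Q1 Q2.
  move=> hQ1 hQ2 Q12; apply: refl => // x [px Q1x]; split=> //.
  exact: (loc_contr_subs hS pS hp hQ1 hQ2).
have lift q : primeR q -> subs q p -> exists Q, prime_in S Q /\ seteq (contrR Q) q.
  move=> hq qp; have [Q [hQ QE]] := surj _ (loc_ext_prime hp hq qp).
  exists Q; split=> // a; rewrite -(loc_ext_contr hp hq qp a).
  split=> [Qa|/QE []//]; apply/QE; split=> //; exact: loc_tofrac.
(* Every prime of [S] contracts into [p], so by order reflection the prime over [p] contains them
   all and is the unique maximal ideal. *)
have [M [hM ME]] := lift p hp (@subs_refl _ p).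
have subM Q : prime_in S Q -> subs Q M.
  by move=> hQ; apply: sub => // a /(contr_subs hp pS hQ) /ME.
have maxM : maximal_in S M.
  split; [exact: hM|exact: (prime1 hM)|move=> J hJ J1 MJ].
  by have [P [hP JP]] := exists_prime_over hS hJ J1; apply: subs_anti => //; apply: subs_trans JP (subM _ hP).
have locS : local_in S.
  exists M; split=> // M' hM'; have hM'P := maximal_prime hS hM'.
  have [_ _ M'max] := hM'; apply: seteq_sym.
  by apply: M'max (subM _ hM'P); [apply: prime_ideal|apply: (prime1 hM)].
have gdS : going_down S.
  move=> q1 q2 hq1 hq2 q12 Q hQ QE.
  have q2p : subs q2 p by move=> a /QE /(contr_subs hp pS hQ).
  have [P [hP PE]] := lift q1 hq1 (subs_trans q12 q2p).
  by exists P; split=> //; apply: sub => // a /PE /q12 /QE.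
have [q [hq SE]] := peri S RS locS gdS.
(* Elements outside [q] are units of [S], hence not in [M], so [p] lies in [q]; elements outside [p]
   have inverses in [loc q], so [q] lies in [p]. *)
suff -> : p = q by [].
apply/seteqE => a; split=> [pa|qa]; apply: contrapT => na.
  apply: (prime1 hM); rewrite -(@mulVf _ a%:F) ?tofrac_eq0 ?(prime_neq0 hq) //.
  by apply: (idealM hM); [apply/SE; apply: loc_inv|apply/ME].
by apply: (loc_inv_tofrac hq _ _ qa); [apply: (prime_neq0 hp)|apply/SE; apply: pS; apply: loc_inv].
Qed.

End Localization.

(** * Intersections of localizations at height one primes *)

Section HeightOne.
Variable R : idomainType.
Local Notation K := {fraction R}.
Local Notation "x %:F" := (@FracField.tofrac R x).
Local Notation primeX := (@prime_in {poly R} fullset).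
Implicit Types (p q : R -> Prop) (x y : K) (a b c d : R) (f g h : {poly R}).

Definition zero_ideal : {poly R} -> Prop := fun f => f = 0.

(* The prime [(q, X)] of [R[X]]. *)
Definition primeX_ext q : {poly R} -> Prop := fun f => q f`_0.

Definition eval_ker y : {poly R} -> Prop := fun f => (map_poly (@FracField.tofrac R) f).[y] = 0.

Lemma zero_ideal_prime : primeX zero_ideal.
Proof. exact: prime_zero. Qed.

Lemma primeX_ext_prime q : primeR q -> primeX (primeX_ext q).
Proof.
move=> hq; rewrite /primeX_ext; split.
- split=> //.
  + by rewrite coef0; apply: (ideal0 hq).
  + by move=> f g qf qg; rewrite coefD; apply: (idealD hq).
  + by move=> f g _ qg; rewrite coef0M; apply: (idealM hq).
- by rewrite coef1; apply: (prime1 hq).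
- by move=> f g _ _; rewrite coef0M; apply: (primeM hq).
Qed.

Lemma primeX_ext_sub q (Q : {poly R} -> Prop) : ideal_in fullset Q -> Q 'X ->
  (forall a, q a -> Q a%:P) -> subs (primeX_ext q) Q.
Proof.
move=> hQ QX qQ f; elim/poly_ind: f => [|f c _]; first by rewrite /primeX_ext coef0 => /qQ.
rewrite /primeX_ext coefD coefMX coefC /= add0r => qc.
by apply: (idealD hQ); [apply: (idealM hQ)|apply: qQ].
Qed.

Lemma eval_ker_prime y : primeX (eval_ker y).
Proof.
rewrite /eval_ker; split; last 1 first.
- move=> f g _ _ /eqP; rewrite rmorphM hornerM mulf_eq0.
  by move=> /orP [] /eqP; [left|right].
- split=> // [|f g Hf Hg|f g _ Hg].
  + by rewrite rmorph0 horner0.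
  + by rewrite rmorphD hornerD Hf Hg addr0.
  + by rewrite rmorphM hornerM Hg mulr0.
- by apply/eqP; rewrite rmorph1 hornerC oner_eq0.
Qed.

Lemma eval_kerC y c : eval_ker y c%:P -> c = 0.
Proof. by rewrite /eval_ker map_polyC hornerC => /eqP; rewrite tofrac_eq0 => /eqP. Qed.

Lemma eval_ker_linear a b : a != 0 -> eval_ker (b%:F / a%:F) (a *: 'X - b%:P).
Proof.
move=> a0; rewrite /eval_ker rmorphB /= map_polyZ map_polyX map_polyC.
by rewrite hornerD hornerN hornerZ hornerX hornerC mulrC divfK ?tofrac_eq0 ?subrr.
Qed.

(** Pseudo-division by [a *: 'X - b%:P] leaves a constant remainder; it lies in the kernel too, so
    it is 0. *)
Lemma eval_ker_pdiv a b f : a != 0 -> eval_ker (b%:F / a%:F) f ->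
  exists k h, a ^+ k *: f = h * (a *: 'X - b%:P).
Proof.
move=> a0 kf; set l := a *: 'X - b%:P; set y := _ / _ in kf.
have sl : size l = 2%N.
  rewrite size_polyDl size_scale ?size_polyX // size_polyN.
  by apply: leq_ltn_trans (size_polyC_leq1 _) _.
have ll : lead_coef l = a.
  by rewrite lead_coefE sl coefB coefZ coefX coefC mulr1 subr0.
have E := Pdiv.Idomain.divp_eq f l; rewrite ll in E.
exists (scalp f l), (f %/ l)%R; rewrite E.
suff -> : (f %% l)%R = 0 by rewrite addr0.
have : (size (f %% l)%R <= 1)%N by rewrite -ltnS -sl ltn_modpN0 // -size_poly_eq0 sl.
move=> /size1_polyC Ec; rewrite Ec; apply/eqP; rewrite polyC_eq0; apply/eqP.
apply: (@eval_kerC y); rewrite -Ec.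
have -> : (f %% l)%R = a ^+ scalp f l *: f - (f %/ l)%R * l by rewrite E addrC addKr.
rewrite -mul_polyC; apply: (idealB _ (eval_ker_prime y)) => //.
  exact: (idealM (eval_ker_prime y)).
by apply: (idealM (eval_ker_prime y)) => //; apply: eval_ker_linear.
Qed.

(** Let [Q] be a prime inside the kernel and [f] a nonzero element of it. Pseudo-division writes a
    power of [a] times [f] as [h * l], so [Q] contains [l] or the smaller polynomial [h], and
    descent on the size gives [l]. Then [Q] contains a power of [a] times any element of the kernel,
    but no nonzero constant. *)
Lemma eval_ker_covers a b : a != 0 -> covers zero_ideal (eval_ker (b%:F / a%:F)).
Proof.
move=> a0; set y := _ / _; set l := a *: 'X - b%:P.
have ly : eval_ker y l by apply: eval_ker_linear.
have l0 : l != 0.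
  apply/eqP => /(congr1 (fun f : {poly R} => f`_1)).
  by rewrite coefB coefZ coefX coefC mulr1 subr0 coef0 => /eqP; rewrite (negPf a0).
split.
- exact: zero_ideal_prime.
- exact: eval_ker_prime.
- by move=> f ->; apply: (ideal0 (eval_ker_prime y)).
- by move=> H; move/eqP: l0; apply; apply: H.
move=> Q hQ _ Qy; have [|nQ0] := pselect (subs Q zero_ideal); [by left|right].
have [f [Qf /eqP f0]] := not_subs nQ0.
have nQa k : ~ Q (a ^+ k)%:P.
  by move=> /Qy /eval_kerC /eqP; apply/negP; rewrite expf_neq0.
have Ql : Q l.
  move: f {2}(size f) (leqnn (size f)) Qf f0 => + n; elim: n => [|n IH] f sf Qf f0.
    by move: sf; rewrite leqn0 size_poly_eq0 (negPf f0).
  have [k [h E]] := eval_ker_pdiv a0 (Qy _ Qf).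
  have : Q (h * l) by rewrite -E -mul_polyC; apply: (idealM hQ).
  case/(primeM hQ) => // Qh.
  have h0 : h != 0.
    apply/eqP => h0; move/eqP: E; rewrite h0 mul0r -mul_polyC mulf_eq0 (negPf f0).
    by rewrite polyC_eq0 expf_eq0 (negPf a0) andbF.
  apply: (IH h) => //; move: sf; rewrite -(size_scale f (expf_neq0 k a0)) E size_mul //.
  suff -> : size l = 2%N by rewrite addn2.
  rewrite size_polyDl size_scale ?size_polyX // size_polyN.
  by apply: leq_ltn_trans (size_polyC_leq1 _) _.
move=> g /(eval_ker_pdiv a0) [k [h E]].
have : Q ((a ^+ k)%:P * g) by rewrite mul_polyC E; apply: (idealM hQ).
by case/(primeM hQ) => // /nQa.
Qed.

Lemma int_closure_inv (S : K -> Prop) x (r : {poly K}) : is_subring S ->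
  (forall i, S r`_i) -> x != 0 -> r.[x^-1] * x^-1 = 1 -> int_closure S x.
Proof.
move=> hS Sr x0 E; set k := size r.
(* Multiplying the hypothesis by [x ^+ k] expresses [x ^+ k] through the powers [x ^+ (k - i.+1)],
   which explains the reversed coefficients and the shift by one. *)
exists ('X^k - \poly_(i < k) r`_(k - i.+1)); split.
- rewrite monicE lead_coefDl ?lead_coefXn // size_polyN size_polyXn.
  by rewrite ltnS; apply: size_poly.
- move=> i; rewrite coefB coefXn coef_poly; apply: subringB => //.
    by case: (i == k); [apply: subring1|apply: subring0].
  by case: ifP => _ //; apply: subring0.
rewrite rootE hornerD hornerN hornerXn horner_poly (reindex_inj rev_ord_inj) /=.
suff -> : \sum_(i < k) r`_(k - (k - i.+1).+1) * x ^+ (k - i.+1) =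
   x ^+ k * (r.[x^-1] * x^-1) by rewrite E mulr1 subrr.
rewrite horner_coef mulr_suml mulr_sumr; apply: eq_bigr => i _.
rewrite subnSK // subKn ?(ltnW (ltn_ord i)) // -mulrA -exprSr mulrCA exprVn; congr (_ * _).
have [->|ki] := eqVneq i.+1 k; first by rewrite subnn mulfV ?expf_neq0.
by rewrite expfB // ltn_neqAle ki ltn_ord.
Qed.

(* If [x = a / b] is not integral over [R_p], take a prime [Q] of [R[X]] minimal over
   [X] and the kernel [N] of [X |-> x^-1].  Then [0 < N < Q] is saturated by the principal
   ideal theorem, and comparing it with [0 < (X) < (q, X) = Q] shows that the
   contraction [q] of [Q] has height one; but [b] is in [q], so that [x] is not in [R_q]. *)
Lemma mem_int_closure p x : universally_catenary R -> primeR p ->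
  (forall q, height_one q -> subs q p -> loc q x) -> int_closure (loc p) x.
Proof.
move=> [noeth ucat] hp hx; apply: contrapT => nint.
have [a [b [b0 xE]]] := fracE x.
have hlp := loc_subring hp.
have [x0|x0] := eqVneq x 0.
  apply: nint; exists 'X; split; first exact: monicX.
    move=> i; rewrite coefX; case: (i == 1%N); first exact: subring1.
    exact: subring0.
  by rewrite rootE hornerX x0.
have a0 : a != 0 by apply: contra_neq x0 => a0; rewrite xE a0 rmorph0 mul0r.
have noethX : noetherian_ring {poly R} by apply: noetherian_poly.
have catX : catenary_ring {poly R}.
  apply: (ucat _ (polyC : {rmorphism R -> {poly R}})).
  exists 1%N, (fun=> 'X) => S hS SC SX f; elim/poly_ind: f => [|f c IH].
    exact: subring0.
  by apply: (subringD hS); [apply: (subringM hS) => //; apply: (SX ord0)|apply: SC].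
pose N := eval_ker (x^-1); pose Z := zero_ideal.
have yE : x^-1 = b%:F / a%:F by rewrite xE invf_div.
have hN : primeX N by apply: eval_ker_prime.
have covN : covers Z N by rewrite /N yE; apply: eval_ker_covers.
have hI : ideal_in fullset (adjoin fullset N 'X) by apply: adjoin_ideal => //; apply: prime_ideal.
(* If [N + (X)] contained a constant [c] outside [p], evaluation at [x^-1] would give
   [c = r(x^-1) x^-1], making [x] integral. So some prime over [N + (X)] contracts into [p]. *)
have [|||||Qt [hQt IQt QtD]] :=
  @exists_prime_disjoint _ fullset (adjoin fullset N 'X) (fun f => exists c, ~ p c /\ f = c%:P) => //.
- by exists 1; split=> //; apply: (prime1 hp).
- move=> _ _ [c [pc ->]] [d [pd ->]]; exists (c * d); rewrite polyCM; split=> //.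
  exact: primeR_prod.
- move=> _ [n [r [Nn _ ->]]] [c [pc E]]; apply: nint.
  have c0 := prime_neq0 hp pc.
  have := congr1 (fun f => (map_poly (@FracField.tofrac R) f).[x^-1]) E.
  rewrite /= rmorphD rmorphM /= map_polyX map_polyC !hornerE Nn add0r => Ec.
  apply: (@int_closure_inv _ _ ((c%:F)^-1 *: map_poly (@FracField.tofrac R) r)) => //.
    move=> i; rewrite coefZ coef_map; apply: subringM => //; first exact: loc_inv.
    exact: loc_tofrac.
  by rewrite hornerZ -mulrA Ec mulVf ?tofrac_eq0.
have NQt : subs N Qt by apply: subs_trans IQt; apply: adjoin_subs.
have QtX : Qt 'X by apply: IQt; apply: adjoin_mem => //; apply: prime_ideal.
have [Q [hQ NQ QX QQt minQ]] := exists_minimal_over hN hQt NQt QtX.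
have nNX : ~ N 'X by rewrite /N /eval_ker map_polyX hornerX => /eqP; rewrite invr_eq0 (negPf x0).
have covQ : covers N Q by apply: (minimal_over_covers noethX hN hQ NQ QX nNX).
pose q c := Q c%:P.
have hq : primeR q by apply: (prime_preim (f := (polyC : {rmorphism R -> {poly R}}))) hQ.
have qp : subs q p by move=> c /QQt qc; apply: contrapT => pc; apply: (QtD _ qc); exists c.
(* All denominators of [x] lie in [q]: if [x = d / c], then [dX - c] is in [N], and subtracting it
   from [dX] leaves [c]. *)
have qmem c d : x * c%:F = d%:F -> c != 0 -> q c.
  move=> E c0; have d0 : d != 0 by rewrite -tofrac_eq0 -E mulf_neq0 // tofrac_eq0.
  rewrite /q -[c%:P](subKr (d *: 'X)); apply: (idealB _ hQ) => //.
    by rewrite -mul_polyC; apply: (idealM hQ).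
  apply: NQ; rewrite /N; have -> : x^-1 = c%:F / d%:F.
    by rewrite -E invfM mulrCA mulfV ?mulr1 // tofrac_eq0.
  exact: eval_ker_linear.
have qb : q b by apply: (qmem b a) => //; rewrite xE divfK // tofrac_eq0.
have ht1 : height_one q.
  split=> //; first by exists b; split=> //; apply/eqP.
  move=> q' hq' q'q; apply: contrapT => /not_orP [q'0 nq'q].
  have [c [q'c c0]] : exists c, q' c /\ c <> 0.
    by apply: contrapT => H; apply: q'0 => c q'c; apply: contrapT => c0; apply: H; exists c.
  have [d [qd nq'd]] : exists d, q d /\ ~ q' d.
    by apply: not_subs => qq'; apply: nq'q; apply: subs_anti.
  (* A prime [q'] strictly between 0 and [q] gives a saturated chain from [Z] to [Q] through [(X)]
     and [(q', X)], of length at least three, against length two through [N]. *)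
  pose X0 := primeX_ext (fun a : R => a = 0); pose X' := primeX_ext q'.
  have hX0 : primeX X0 by apply: primeX_ext_prime (prime_zero _).
  have hX' : primeX X' by apply: primeX_ext_prime.
  have covX0 : covers Z X0.
    apply: (@minimal_over_covers _ noethX Z 'X X0 zero_ideal_prime hX0).
    - by move=> f ->; apply: (ideal0 hX0).
    - by rewrite /X0 /primeX_ext coefX.
    - by move/eqP; rewrite polyX_eq0.
    - by move=> P hP _ PX _; apply: (primeX_ext_sub (prime_ideal hP) PX) => _ ->; apply: (ideal0 hP).
  have [n chn] : exists n, cover_chain X0 X' n.+1.
    apply: exists_cover_chain_gt0 => //.
      by move=> f; rewrite /X0 /X' /primeX_ext => ->; apply: (ideal0 hq').
    by move=> /(_ c%:P); rewrite /X0 /X' /primeX_ext coefC /= => /(_ q'c).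
  have [m chm] : exists m, cover_chain X' Q m.+1.
    apply: exists_cover_chain_gt0 => //.
      by apply: (primeX_ext_sub (prime_ideal hQ) QX) => e /q'q.
    by move=> /(_ d%:P qd); rewrite /X' /primeX_ext coefC.
  have ch1 := cover_chainS covX0 (cover_chain_cat chn chm).
  have ch2 := cover_chainS covN (cover_chainS covQ (cover_chain0 hQ)).
  have ZQ : subs Z Q by move=> f ->; apply: (ideal0 hQ).
  by have := catenary_cover_chain catX zero_ideal_prime hQ ZQ ch1 ch2; rewrite addnS.
have [c [d [qd]]] := hx q ht1 qp.
have d0 := prime_neq0 hq qd.
by move=> E; apply: qd; apply: (qmem d c) => //; rewrite E divfK // tofrac_eq0.
Qed.

End HeightOne.

(** * Going-down overrings under (R1) *)

Section Contraction.
Variable R : idomainType.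
Local Notation K := {fraction R}.

Lemma contr_ideal (S S' Q : K -> Prop) : is_subring S -> subs S S' -> ideal_in S' Q ->
  ideal_in S (fun x => S x /\ Q x).
Proof.
move=> hS SS' hQ; split.
- by move=> x [].
- by split; [apply: subring0|apply: (ideal0 hQ)].
- by move=> x y [Sx Qx] [Sy Qy]; split; [apply: subringD|apply: (idealD hQ)].
- by move=> x y Sx [Sy Qy]; split; [apply: subringM|apply: (idealM hQ (SS' _ Sx))].
Qed.

Lemma loc_contr_eq p (Q q : K -> Prop) : primeR p -> prime_in (loc p) q ->
  ideal_in (loc p) (fun x => loc p x /\ Q x) -> seteq (contrR Q) (contrR q) ->
  seteq (fun x => loc p x /\ Q x) q.
Proof.
move=> hp hq hQ QE; have hl := loc_subring hp.
move=> x; split=> [[px Qx]|qx].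
  apply: (loc_contr_subs hl (@subs_refl _ _) hp hQ (prime_ideal hq) _ px) => //.
  by move=> a [_ /QE].
have px := idealS hq qx.
apply: (loc_contr_subs hl (@subs_refl _ _) hp (prime_ideal hq) hQ _ px) => //.
by move=> a /QE Qa; split=> //; apply: loc_tofrac.
Qed.

End Contraction.

Section GoingDown.
Variable R : idomainType.
Local Notation K := {fraction R}.
Local Notation "x %:F" := (@FracField.tofrac R x).
Implicit Types (p q : R -> Prop) (S P Q : K -> Prop) (x y u s t : K) (a b c d : R).
Hypotheses (ucR : universally_catenary R) (R1R : R1 R).

(** If [u / s] is not in [loc q], then (R1) gives [s / u = c / d] with [d] outside [q] and [c] in
    [q]. A prime [P] inside [Q] over [q] contains [c * u = s * d] but not [d], so it contains [s],
    although [s] is outside [Q]. *)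
Lemma going_down_integral S Q u s : overring S -> going_down S -> prime_in S Q ->
  S u -> S s -> ~ Q s -> int_closure (loc (contrR Q)) (u / s).
Proof.
move=> RS gd hQ Su Ss Qs; have hp := prime_contr RS hQ; have [hS RS'] := RS.
apply: mem_int_closure => // q ht1 qp; have [hq _ _] := ht1.
have s0 : s != 0 by apply/eqP => s0; apply: Qs; rewrite s0; apply: (ideal0 hQ).
have [u0|u0] := eqVneq u 0.
  by rewrite u0 mul0r -(rmorph0 (@FracField.tofrac R)); apply: loc_tofrac.
have [P [hP PQ PE]] := gd q (contrR Q) hq hp qp Q hQ (fun a => iff_refl _).
have /eqP us0 : u / s != 0 by rewrite mulf_neq0 ?invr_neq0.
have [//|[c [d [qd E]]]] := R1R ht1 us0.
have d0 := prime_neq0 hq qd.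
have [qc|nqc] := pselect (q c); last first.
  by exists d, c; split=> //; rewrite -[LHS]invrK E invf_div.
have Ecd : s * d%:F = c%:F * u.
  rewrite invf_div in E; apply/eqP.
  by rewrite -eqr_div ?tofrac_eq0 // E.
have : P (s * d%:F).
  by rewrite Ecd; apply: (ideal_mulr hP) => //; apply/PE.
by case/(primeM hP Ss (RS' d)) => [/PQ //|/PE /qd].
Qed.

(** For [t] in [Q2] outside [Q1], the inverse of [t] is integral over the localization at the common
    contraction. Multiplying its equation by [t ^+ k] writes 1 as a combination of positive powers
    of [t], so 1 would lie in the extension of [Q2]. *)
Lemma going_down_unibranched S Q1 Q2 : overring S -> going_down S ->
  prime_in S Q1 -> prime_in S Q2 -> subs (contrR Q2) (contrR Q1) ->
  subs (contrR Q1) (contrR Q2) -> subs Q2 Q1.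
Proof.
move=> RS gd hQ1 hQ2 Q21 Q12 t Q2t; apply: contrapT => Q1t.
have [hS RS'] := RS; have St := idealS hQ2 Q2t.
have t0 : t != 0 by apply/eqP => t0; apply: Q1t; rewrite t0; apply: (ideal0 hQ1).
have hq := prime_contr RS hQ1.
have [f [mf cf]] := going_down_integral RS gd hQ1 (subring1 hS) St Q1t.
rewrite mul1r => /rootP rf.
(* [W] is the extension of [Q2] to the ring of fractions of [S] with denominators outside the common
   contraction. *)
pose W w := exists d, ~ contrR Q1 d /\ Q2 (d%:F * w).
have WD v w : W v -> W w -> W (v + w).
  move=> [c [qc Qv]] [d [qd Qw]]; exists (c * d); split; first exact: primeR_prod.
  rewrite rmorphM mulrDr; apply: (idealD hQ2).
    by rewrite mulrAC; apply: (ideal_mulr hQ2 (RS' d)).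
  by rewrite -mulrA; apply: (idealM hQ2 (RS' c)).
have Wloc v w : loc (contrR Q1) v -> W w -> W (v * w).
  move=> [a [b [qb ->]]] [d [qd Qw]]; exists (b * d); split; first exact: primeR_prod.
  have -> : (b * d)%:F * (a%:F / b%:F * w) = a%:F * (d%:F * w).
    rewrite rmorphM mulrACA [b%:F * _]mulrC divfK ?tofrac_eq0 //.
    exact: (prime_neq0 hq).
  exact: (idealM hQ2 (RS' a)).
have W0 : W 0 by exists 1; rewrite mulr0; split; [apply: (prime1 hq)|apply: (ideal0 hQ2)].
have Wt n : W (t ^+ n.+1).
  exists 1; rewrite rmorph1 mul1r exprS; split; first exact: (prime1 hq).
  by apply: (ideal_mulr hQ2) => //; apply: subringX.
have [k sf] : exists k, size f = k.+1.
  by exists (size f).-1; rewrite prednK // size_poly_gt0 monic_neq0.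
have fk : f`_k = 1 by move/monicP: mf; rewrite lead_coefE sf.
have E : 1 = \sum_(i < k) (- f`_i) * t ^+ (k - i).
  apply/eqP; rewrite -subr_eq0; apply/eqP.
  transitivity (t ^+ k * f.[t^-1]); last by rewrite rf mulr0.
  rewrite horner_coef sf big_ord_recr /= fk mul1r mulrDr exprVn mulfV ?expf_neq0 // addrC.
  congr (_ + 1); rewrite mulr_sumr -sumrN; apply: eq_bigr => i _.
  rewrite mulNr opprK mulrCA; congr (_ * _).
  by rewrite exprVn expfB.
have : W 1.
  rewrite E; elim/big_ind: _ => // i _; apply: Wloc.
    by apply: subringN (cf i); apply: loc_subring.
  by rewrite -(subnSK (ltn_ord i)).
by move=> [d [qd]]; rewrite mulr1 => /Q21 /qd.
Qed.

Hypothesis unib : forall p, primeR p -> forall S : K -> Prop,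
  is_subring S -> subs (loc p) S -> subs S (int_closure (loc p)) ->
  order_refl_bij (loc p) S -> seteq S (loc p).

Lemma unibranched_perinormal : perinormal R.
Proof.
move=> S RS [M [hM Muniq]] gd; have [hS RS'] := RS.
have hMP := maximal_prime hS hM; have hp := prime_contr RS hMP.
set p := contrR M in hp.
have pS : subs (loc p) S.
  by apply: loc_min => // b pb; apply: (local_inv hS Muniq).
exists p; split=> //; apply: unib => //.
  move=> x Sx; rewrite -[x]divr1; apply: (going_down_integral RS gd hMP Sx) => //.
    exact: subring1.
  exact: (prime1 hMP).
(* Going-down provides a prime [P] inside [Q2] with the contraction of [Q1]; primes with equal
   contractions coincide, so [P] is [Q1]. *)
have inj Q1 Q2 : prime_in S Q1 -> prime_in S Q2 -> subs (contrR Q1) (contrR Q2) ->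
    subs Q1 Q2.
  move=> hQ1 hQ2 Q12.
  have [P [hP PQ2 PE]] := gd _ _ (prime_contr RS hQ1) (prime_contr RS hQ2) Q12 Q2 hQ2
    (fun a => iff_refl _).
  apply: subs_trans PQ2; by apply: (going_down_unibranched RS gd hP hQ1) => a /PE.
have cc Q1 Q2 : subs (fun x => loc p x /\ Q1 x) (fun x => loc p x /\ Q2 x) ->
    subs (contrR Q1) (contrR Q2).
  by move=> Q12 a Q1a; have [|_] := Q12 a%:F => //; split=> //; apply: loc_tofrac.
split.
- move=> q hq; have Rp := loc_overring hp; have hq' := prime_contr Rp hq.
  have qp : subs (contrR q) p by apply: contr_subs hq.
  have [Q [hQ QM QE]] := gd _ _ hq' hp qp M hMP (fun a => iff_refl _).
  exists Q; split=> //; apply: (loc_contr_eq hp hq _ QE).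
  by apply: contr_ideal (prime_ideal hQ) => //; apply: loc_subring.
- move=> Q1 Q2 hQ1 hQ2 Q12.
  by apply: subs_anti; apply: inj => //; apply: cc => x /Q12.
- by move=> Q1 Q2 hQ1 hQ2 /cc; apply: inj.
Qed.

End GoingDown.

(** * Maximal overrings and valuations *)

Section AdjoinRing.
Variable T : comNzRingType.
Implicit Types (S : T -> Prop) (u : T).

Definition adjoin_ring S u : T -> Prop :=
  fun z => exists f : {poly T}, (forall i, S f`_i) /\ z = f.[u].

Lemma adjoin_ring_subring S u : is_subring S -> is_subring (adjoin_ring S u).
Proof.
move=> hS; split.
- exists 1; split; last by rewrite hornerC.
  by move=> i; rewrite coef1; case: (i == 0)%N; [apply: subring1|apply: subring0].
- move=> _ _ [f [Sf ->]] [g [Sg ->]]; exists (f - g); rewrite hornerD hornerN; split=> // i.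
  by rewrite coefB; apply: subringB.
- move=> _ _ [f [Sf ->]] [g [Sg ->]]; exists (f * g); rewrite hornerM; split=> // i.
  by rewrite coefM; apply: subring_sum => // j; apply: subringM.
Qed.

Lemma adjoin_ring_subs S u : is_subring S -> subs S (adjoin_ring S u).
Proof.
move=> hS x Sx; exists x%:P; rewrite hornerC; split=> // i.
by rewrite coefC; case: (i == 0)%N => //; apply: subring0.
Qed.

Lemma adjoin_ring_mem S u : is_subring S -> adjoin_ring S u u.
Proof.
move=> hS; exists 'X; rewrite hornerX; split=> // i.
by rewrite coefX; case: (i == 1)%N; [apply: subring1|apply: subring0].
Qed.

End AdjoinRing.

Section RankOne.
Variable R : idomainType.
Local Notation K := {fraction R}.
Local Notation "x %:F" := (@FracField.tofrac R x).
Implicit Types (p q : R -> Prop) (S P Q M : K -> Prop) (a b c d : R).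

(** If [w = c / d] satisfies a monic equation of degree [k], every power of [w] reduces to powers
    below [k], and [d ^+ k] clears their denominators. *)
Lemma adjoin_integral_denominator M w : overring M -> int_closure M w ->
  exists e : R, e != 0 /\ forall z, adjoin_ring M w z -> M (e%:F * z).
Proof.
move=> [hM RM] [q [mq Mq /rootP rq]].
have [c [d [d0 wE]]] := fracE w.
have dF0 : d%:F != 0 by rewrite tofrac_eq0.
have [k sq] : exists k, size q = k.+1.
  by exists (size q).-1; rewrite prednK // size_poly_gt0 monic_neq0.
have qk : q`_k = 1 by move/monicP: mq; rewrite lead_coefE sq.
have wk : w ^+ k = \sum_(i < k) (- q`_i) * w ^+ i.
  apply/eqP; rewrite -subr_eq0 -[X in _ == X]rq horner_coef sq big_ord_recr /= qk mul1r addrC.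
  by apply/eqP; congr (_ + _); rewrite -sumrN; apply: eq_bigr => i _; rewrite mulNr opprK.
have Mw n : M ((d ^+ k)%:F * w ^+ n).
  elim/ltn_ind: n => n IH; have [nk|kn] := ltnP n k.
    have -> : (d ^+ k)%:F * w ^+ n = (d ^+ (k - n) * c ^+ n)%:F.
      have -> : d ^+ k = d ^+ (k - n) * d ^+ n by rewrite -exprD subnK // ltnW.
      rewrite wE expr_div_n !rmorphM !rmorphXn.
      by rewrite -mulrA [d%:F ^+ n * _]mulrC divfK // expf_neq0.
    exact: RM.
  rewrite -(subnK kn) exprD wk mulr_sumr mulr_sumr; apply: subring_sum => // i.
  rewrite [w ^+ _ * _]mulrCA -exprD mulrCA; apply: subringM => //; first exact: subringN.
  by apply: IH; rewrite -ltn_subRL subKn.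
exists (d ^+ k); split=> [|z [f [Mf ->]]]; first by rewrite expf_neq0.
rewrite horner_coef mulr_sumr; apply: subring_sum => // i.
by rewrite mulrCA; apply: subringM.
Qed.

(* A maximal proper overring is a valuation ring: it is integrally closed, as adjoining
   an integral element only introduces bounded denominators, and [u^-1 \in M[u]]
   makes [u^-1] integral over [M]. *)
Lemma maximal_overring_valuation M : overring M -> (exists z, ~ M z) ->
  (forall S, is_subring S -> subs M S -> ~ subs S M -> forall z, S z) -> valuation_in M.
Proof.
move=> RM [z nMz] Mmax u /eqP u0; have [hM _] := RM.
have full v : ~ M v -> forall z, adjoin_ring M v z.
  move=> nMv; apply: Mmax; [exact: adjoin_ring_subring|exact: adjoin_ring_subs|].
  by move=> /(_ v) H; apply: nMv; apply: H; apply: adjoin_ring_mem.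
apply: contrapT => /not_orP [nMu nMui].
have [f [Mf Ef]] := full u nMu u^-1.
have intu : int_closure M u^-1.
  by apply: (int_closure_inv (r := f)); rewrite ?invr_eq0 // invrK -Ef mulVf.
have [e [e0 He]] := adjoin_integral_denominator RM intu.
(* [M[u^-1]] is all of [K], so [e K] lies in [M], and [e K] is [K]. *)
apply: nMz; rewrite -[z](@mulVKf _ e%:F) ?tofrac_eq0 //; apply: He.
exact: full.
Qed.

(** That is, inverting [x] in [loc p] gives all of [K]. Otherwise some prime contains [d] and avoids
    every [s * x ^+ k]; it lies in [p] and is nonzero, so it is [p], which contains [x]. *)
Lemma height_one_pow p (x d : R) : height_one p -> p x -> d != 0 ->
  exists (k : nat) (s a : R), ~ p s /\ s * x ^+ k = a * d.
Proof.
move=> [hp _ pmin] px d0; apply: contrapT => H.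
have h0 := ideal_zero (@fullset_subring R).
have hd : ideal_in fullset (adjoin fullset (fun y => y = 0) d) by apply: adjoin_ideal.
have [|||||Q [hQ IQ QD]] := @exists_prime_disjoint _ fullset
  (adjoin fullset (fun y => y = 0) d) (fun y => exists k s, ~ p s /\ y = s * x ^+ k) => //.
- by exists 0%N, 1; rewrite mul1r expr0; split=> //; apply: (prime1 hp).
- move=> _ _ [k [s [ps ->]]] [m [t [pt ->]]]; exists (k + m)%N, (s * t).
  by rewrite exprD mulrACA; split=> //; apply: primeR_prod.
- move=> _ [c [a [-> _ ->]]] [k [s [ps E]]]; apply: H; exists k, s, a.
  by rewrite -E add0r.
have Qp : subs Q p.
  move=> y Qy; apply: contrapT => py; apply: (QD y Qy); exists 0%N, y.
  by rewrite expr0 mulr1.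
have Qd : Q d by apply: IQ; apply: adjoin_mem.
have [Q0|QE] := pmin Q hQ Qp; first by move/eqP: d0; apply; apply: Q0.
apply: (QD x); first by apply/QE.
by exists 1%N, 1; rewrite mul1r expr1; split=> //; apply: (prime1 hp).
Qed.

Lemma unibranched_R1 :
  (forall p, primeR p -> forall S : K -> Prop,
     is_subring S -> subs (loc p) S -> order_refl_bij (loc p) S -> seteq S (loc p)) -> R1 R.
Proof.
move=> unib p ht1; have [hp [x0 [px0 /eqP x00]] pmin] := ht1.
pose x := x0%:F; have hl := loc_subring hp.
have xn0 : x != 0 by rewrite tofrac_eq0.
have nlx : ~ loc p x^-1 by move=> /(loc_inv_tofrac hp x00); apply.
have [||M [[hM nMx] pM Mmax]] :=
  @zorn_union _ (fun S => is_subring S /\ ~ S x^-1) (loc p); first by [].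
  move=> F FP [A0 FA0] Ftot; split; last by move=> [A [/FP[_ nA] Ax]]; apply: nA.
  have pair A B y z : F A -> F B -> A y -> B z -> exists C, [/\ F C, C y & C z].
    move=> FA FB Ay Bz; have [AB|BA] := Ftot A B FA FB.
      by exists B; split=> //; apply: AB.
    by exists A; split=> //; apply: BA.
  split.
  - by exists A0; split=> //; have [/subring1] := FP _ FA0.
  - move=> y z [A [FA Ay]] [B [FB Bz]]; have [C [FC Cy Cz]] := pair A B y z FA FB Ay Bz.
    by exists C; split=> //; have [hC _] := FP _ FC; apply: subringB.
  - move=> y z [A [FA Ay]] [B [FB Bz]]; have [C [FC Cy Cz]] := pair A B y z FA FB Ay Bz.
    by exists C; split=> //; have [hC _] := FP _ FC; apply: subringM.
have RM := overring_loc hp hM pM; have [_ RM'] := RM.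
(* A ring strictly above [M] contains [x^-1], hence every fraction. So [M] is a maximal proper
   overring. *)
have full S : is_subring S -> subs M S -> ~ subs S M -> forall z, S z.
  move=> hS MS nSM z.
  have Sx : S x^-1.
    by apply: contrapT => nSx; apply: nSM; apply: Mmax.
  have [a [b [b0 ->]]] := fracE z.
  have [k [s [c [ps E]]]] := height_one_pow ht1 px0 b0.
  have s0 := prime_neq0 hp ps.
  have -> : a%:F / b%:F = (a * c)%:F * ((s%:F)^-1 * x^-1 ^+ k).
    apply/eqP; rewrite exprVn -invfM -rmorphXn -rmorphM E eqr_div ?tofrac_eq0 //.
      by rewrite -!rmorphM mulrA.
    by rewrite -E mulf_neq0 // expf_neq0.
  apply: subringM => //; first by apply: MS.
  apply: subringM => //; last exact: subringX.
  by apply: MS; apply: pM; apply: loc_inv.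
have contr_p Q y : prime_in M Q -> Q y -> y != 0 -> seteq (contrR Q) p.
  move=> hQ Qy y0; have [a [b [b0 yE]]] := fracE y.
  have [|Q0|//] := pmin (contrR Q) (prime_contr RM hQ).
    exact: contr_subs hQ.
  have a0 : a = 0.
    apply: Q0; rewrite /contrR; have -> : a%:F = y * b%:F by rewrite yE divfK // tofrac_eq0.
    exact: (ideal_mulr hQ).
  by move/eqP: y0; case; rewrite yE a0 rmorph0 mul0r.
(* A nonzero [y] in [Q1] is not a unit of [M], so [M[y^-1]] is [K] and contains [x^-1]. Clearing
   denominators puts a power of [y] in [x M], which lies in [Q2]. *)
have inj Q1 Q2 : prime_in M Q1 -> prime_in M Q2 ->
    subs (fun x => loc p x /\ Q1 x) (fun x => loc p x /\ Q2 x) -> subs Q1 Q2.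
  move=> hQ1 hQ2 Q12 y Q1y; have [->|y0] := eqVneq y 0; first exact: (ideal0 hQ2).
  have Q2x : Q2 x.
    have [|_] := Q12 x => //; split; first exact: loc_tofrac.
    by apply/(contr_p _ _ hQ1 Q1y y0).
  have My := idealS hQ1 Q1y.
  have nMy : ~ M y^-1.
    by move=> Myi; apply: (prime1 hQ1); rewrite -(mulVf y0); apply: (idealM hQ1).
  have [|||f [Mf Ef]] := full (adjoin_ring M y^-1) _ _ _ x^-1.
  - exact: adjoin_ring_subring.
  - exact: adjoin_ring_subs.
  - by move=> /(_ y^-1) H; apply: nMy; apply: H; apply: adjoin_ring_mem.
  apply: (@primeX _ _ _ y (size f) hM hQ2 My).
  have -> : y ^+ size f = (y ^+ size f * f.[y^-1]) * x by rewrite -Ef divfK.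
  apply: (idealM hQ2) => //; rewrite horner_coef mulr_sumr; apply: subring_sum => // i.
  rewrite mulrCA exprVn -expfB //; apply: subringM => //; exact: subringX.
suff ME : seteq M (loc p).
  by rewrite -(seteqE ME); apply: maximal_overring_valuation => //; exists x^-1.
apply: unib => //; split=> //.
- move=> q hq; have hq' := prime_contr (loc_overring hp) hq.
  have qp : subs (contrR q) p by apply: contr_subs hq.
  (* The only contractions to lift are 0, by the zero ideal, and [p], by any prime containing the
     nonunit [x] of [M]. *)
  have [Q [hQ QE]] : exists Q, prime_in M Q /\ seteq (contrR Q) (contrR q).
    have [q0|qE] := pmin _ hq' qp.
      exists (fun z => z = 0); split.
        exact: prime_zero.
      move=> a; rewrite /contrR; split=> [/eqP|/q0 ->]; last by rewrite rmorph0.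
      rewrite tofrac_eq0 => /eqP ->; rewrite rmorph0; exact: (ideal0 hq).
    have [I [hI I1 Ix]] := nonunit_proper hM (RM' x0) nMx.
    have [Q [hQ IQ]] := exists_prime_over hM hI I1; exists Q; split=> //.
    exact: seteq_trans (contr_p Q x hQ (IQ x Ix) xn0) (seteq_sym qE).
  exists Q; split=> //; apply: (loc_contr_eq hp hq _ QE).
  by apply: contr_ideal (prime_ideal hQ).
- move=> Q1 Q2 hQ1 hQ2 Q12.
  by apply: subs_anti; apply: inj => // y /Q12.
Qed.

End RankOne.

Theorem theorem4p7 (R : idomainType) :
  universally_catenary R ->
  [<-> perinormal R;
       (forall p, primeR p -> forall S : {fraction R} -> Prop,
          is_subring S -> subs (loc p) S -> order_refl_bij (loc p) S ->
          seteq S (loc p));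
       R1 R /\
       (forall p, primeR p -> forall S : {fraction R} -> Prop,
          is_subring S -> subs (loc p) S -> subs S (int_closure (loc p)) ->
          order_refl_bij (loc p) S -> seteq S (loc p))].
Proof.
move=> ucR; split; first exact: perinormal_unibranched.
split; last by move=> [R1R unib]; apply: unibranched_perinormal.
move=> unib; split; first exact: unibranched_R1.
by move=> p hp S hS pS _; apply: unib.
Qed.
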